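(* There is an absolute constant $c>0$ such that the following holds. For all integers $n,m\ge 1$, if $M$ is an $n\times n$ random matrix whose entries are independent and uniformly distributed on $\{-m,-m+1,\ldots,m\}$, then $$\Pr[M \text{ is singular}] \le m^{-cn}.$$
   Context: $c$ does not depend on $n$ or $m$. *)

(* Defs.v *)
From mathcomp Require Import all_boot all_order all_algebra.
From Stdlib Require Import Reals.

Set Implicit Arguments.
Unset Strict Implicit.
Unset Printing Implicit Defensive.

Import GRing.Theory.
Local Open Scope ring_scope.

Definition sym_entry (m : nat) (k : 'I_(2 * m + 1)) : int :=
  (Posz (nat_of_ord k) - Posz m : int).

Definition int_mx (n m : nat) (A : 'M['I_(2 * m + 1)]_n) : 'M[int]_n :=
  map_mx (@sym_entry m) A.

Definition singular_int (n : nat) (B : 'M[int]_n) : bool := (\det B == 0 :> int).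

(* Probability (w.r.t. the uniform distribution on all matrices with
   independent uniform entries in {-m,...,m}, i.e. the uniform distribution
   on the finite set of such matrices) that the matrix is singular. *)
Definition prob_singular (n m : nat) : R :=
  Rdiv (INR #|[set A : 'M['I_(2 * m + 1)]_n | singular_int (int_mx A)]|)
       (INR #|{: 'M['I_(2 * m + 1)]_n}|).

(* Main.v *)
Require Import Defs.
From mathcomp Require Import all_boot all_order all_algebra.
From mathcomp Require Import ring lra zify.
From mathcomp Require Import complex reals Rstruct.
Set Implicit Arguments.
Unset Strict Implicit.
Unset Printing Implicit Defensive.
Import Order.TTheory GRing.Theory Num.Theory.
Local Open Scope ring_scope.

(** A determinant vanishing over the integers vanishes modulo a huge prime p, so
one works over F_p and exposes the rows X_1, ..., X_n one at a time, following
the space they span. If they span a hyperplane V, compare them with rows Y whose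
entries are very lazy differences of uniform variables (the exchange argument of
Kahn, Komlós, Szemerédi and of Tao and Vu): about n/2 rows Y that are
independent in V can replace as many rows X, at the price of a factor
(P(X in V) / P(Y in V))^(n/2) and of a binomial coefficient at most 2^n.
Fourier analysis on F_p gives P(X in V) <= 1/p + eps P(Y in V): the large
Fourier coefficients of X sit in a ball D of the seminorm
xi |-> (sum_j |1 - e(xi v_j / p)|^2)^(1/2), where v is the normal vector of V,
those of Y are still near 1 on a ball of a radius many times larger, and
the latter ball is many times larger in cardinality, since the multiples of an
element of the former leave it by small steps. For m bounded, eps < 1/4 is
enough; for m large, eps is a small power of 1/m. *)

(** * The chain of row spaces *)

Definition avg (R : realFieldType) (O : finType) (f : O -> R) : R :=
  (\sum_w f w) / #|O|%:R.

Section Average.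
Variables (R : realFieldType) (O : finType).
Implicit Types f g : O -> R.

Lemma eq_avg f g : f =1 g -> avg f = avg g.
Proof. by move=> fg; rewrite /avg (eq_bigr _ (fun w _ => fg w)). Qed.

Lemma ler_avg f g : (forall w, f w <= g w) -> avg f <= avg g.
Proof. by move=> fg; rewrite ler_wpM2r ?invr_ge0 ?ler0n ?ler_sum. Qed.

Lemma avg_ge0 f : (forall w, 0 <= f w) -> 0 <= avg f.
Proof. by move=> f0; rewrite divr_ge0 ?ler0n ?sumr_ge0. Qed.

Lemma avgD f g : avg (fun w => f w + g w) = avg f + avg g.
Proof. by rewrite /avg big_split mulrDl. Qed.

Lemma avgZ c f : avg (fun w => c * f w) = c * avg f.
Proof. by rewrite /avg -mulr_sumr mulrA. Qed.

Lemma avg_sum (I : finType) (P : pred I) (F : I -> O -> R) :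
  avg (fun w => \sum_(i | P i) F i w) = \sum_(i | P i) avg (F i).
Proof. by rewrite /avg exchange_big mulr_suml. Qed.

Lemma avg_const (c : R) : (0 < #|O|)%N -> avg (fun _ : O => c) = c.
Proof.
by move=> O0; rewrite /avg sumr_const -[c *+ _]mulr_natr mulfK // pnatr_eq0 -lt0n.
Qed.

End Average.

Lemma mxrank_adds_row (F : fieldType) n (W : 'M[F]_n) (x : 'rV_n) :
  \rank (W + x)%MS = (\rank W + ~~ (x <= W)%MS)%N.
Proof.
have [xW|xW] := boolP (x <= W)%MS.
  by rewrite addn0 (addsmx_idPl xW).
apply/eqP; rewrite eqn_leq addn1; apply/andP; split.
  apply: leq_trans (mxrank_adds_leqif _ _).1 _.
  by have := rank_leq_row x; lia.
by rewrite rank_ltmx // ltmxE addsmxSl addsmx_sub submx_refl.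
Qed.

Section Chain.
Variables (R : realFieldType) (F : finFieldType) (n : nat).
Implicit Types (U V W : 'M[F]_n) (f g : 'M[F]_n -> R).

Section OneChain.
Variables (O : finType) (r : O -> 'rV[F]_n).
Hypothesis O0 : (0 < #|O|)%N.

(** [chain k f W] is the expected value of [f] at the space spanned by [W] and [k] independent rows;
    [chainS] conditions on the first of them. *)
Definition step f W := avg (fun w => f (W + r w)%MS).
Definition chain k f := iter k step f.
Definition mass U : R := avg (fun w => (r w <= U)%MS%:R).
Definition ind V W : R := (W == V)%MS%:R.

Lemma chainS k f W : chain k.+1 f W = avg (fun w => chain k f (W + r w)%MS).
Proof. by []. Qed.

Lemma ler_chain k f g W : (forall U, f U <= g U) -> chain k f W <= chain k g W.
Proof. by move=> fg; elim: k W => //= k IHk W; apply: ler_avg. Qed.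

Lemma chain_ge0 k f W : (forall U, 0 <= f U) -> 0 <= chain k f W.
Proof. by move=> f0; elim: k W => //= k IHk W; apply: avg_ge0. Qed.

Lemma chainZ k c f W : chain k (fun U => c * f U) W = c * chain k f W.
Proof.
elim: k W => //= k IHk W; rewrite /step -avgZ; exact: eq_avg.
Qed.

Lemma chain_sum k (I : finType) (P : pred I) (f : I -> 'M[F]_n -> R) W :
  chain k (fun U => \sum_(i | P i) f i U) W = \sum_(i | P i) chain k (f i) W.
Proof.
elim: k W => //= k IHk W; rewrite /step -avg_sum; exact: eq_avg.
Qed.

Lemma chain_const k (c : R) W : chain k (fun => c) W = c.
Proof.
by elim: k W => //= k IHk W; rewrite /step (eq_avg (fun w => IHk _)) avg_const.
Qed.

Lemma mass_ge0 U : 0 <= mass U.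
Proof. by apply: avg_ge0 => w; rewrite ler0n. Qed.

Lemma mass_le1 U : mass U <= 1.
Proof.
rewrite -(avg_const (1 : R) O0); apply: ler_avg => w; by case: (_ <= _)%MS.
Qed.

Lemma ind_ge0 V W : 0 <= ind V W. Proof. exact: ler0n. Qed.

Hypothesis mass3 : forall U, mass U <= 3^-1 ^+ (n - \rank U).

(** The probability is at least the product of the factors 1 - 3^-i for i from 1 to [k]. The term
    3^-k / 2 strengthens the bound 1/2 just enough for the induction to close. *)
Lemma chain_independent k W : (\rank W + k <= n)%N ->
  1 / 2 + 3^-1 ^+ k / 2 <= chain k (fun U => (\rank U == \rank W + k)%N%:R) W.
Proof.
elim: k W => [|k IHk] W Wk.
  by rewrite /= addn0 eqxx expr0 /=; lra.
set y := 3^-1 ^+ k in IHk *.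
have y0 : 0 < y by rewrite exprn_gt0 // invr_gt0.
have y1 : y <= 1 by rewrite exprn_ile1 //; lra.
have mW : mass W <= y / 3.
  apply: le_trans (mass3 W) _; rewrite -[y / 3]exprSr.
  by apply: ler_wiXn2l; [lra | lra | lia].
have lb : (1 - mass W) * (1 / 2 + y / 2) <=
    chain k.+1 (fun U => (\rank U == \rank W + k.+1)%N%:R) W.
  rewrite chainS -[X in X - _](avg_const (1 : R) O0).
  rewrite -[- mass W]mulN1r -avgZ -avgD mulrC -avgZ; apply: ler_avg => w.
  have [wW|wW] := boolP (r w <= W)%MS.
    rewrite mulN1r subrr mulr0; apply: chain_ge0 => U; exact: ler0n.
  rewrite mulr0 addr0 mulr1.
  have rk : \rank (W + r w)%MS = (\rank W).+1 by rewrite mxrank_adds_row wW addn1.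
  by have := IHk (W + r w)%MS; rewrite rk addnS addSn => -> //; lia.
apply: le_trans lb; rewrite exprSr -/y.
by nra.
Qed.

(* At the first dependent row the rank falls one behind, and by
   chain_independent it falls no further with probability at least 1/2. *)
Lemma singular_le_corank1 k W : (\rank W + k = n)%N ->
  chain k (fun U => (\rank U < n)%N%:R) W <=
  2 * chain k (fun U => (\rank U == n.-1)%N%:R) W.
Proof.
elim: k W => [|k IHk] W Wk.
  by rewrite /= (_ : (\rank W < n)%N = false) ?mulr_ge0 ?ler0n //; lia.
rewrite !chainS -avgZ; apply: ler_avg => w.
have [wW|wW] := boolP (r w <= W)%MS; last first.
  by apply: IHk; rewrite mxrank_adds_row wW; lia.
have rk : \rank (W + r w)%MS = \rank W by rewrite mxrank_adds_row wW addn0.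
have := chain_independent (k := k) (W := (W + r w)%MS).
rewrite rk (_ : (\rank W + k)%N = n.-1); last lia.
rewrite leq_pred => /(_ isT) lb.
have ub : chain k (fun U => (\rank U < n)%N%:R) (W + r w)%MS <= 1.
  rewrite -[leRHS](chain_const k 1 (W + r w)%MS); apply: ler_chain => U.
  by rewrite lern1 leq_b1.
have : (0 : R) <= 3^-1 ^+ k by rewrite exprn_ge0 // invr_ge0.
by move: ub lb; set A := chain _ _ _; set B := chain _ _ _; lra.
Qed.

End OneChain.

(** * The exchange inequality for one chain *)

Section Exchange.
Variables (O : finType) (r : O -> 'rV[F]_n).
Hypothesis O0 : (0 < #|O|)%N.

Lemma chain_ind_eq0 k V W : ~~ (W <= V)%MS -> chain r k (ind V) W = 0.
Proof.
elim: k W => [|k IHk] W WV /=; first by rewrite /ind (negbTE WV).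
have IH w : chain r k (ind V) (W + r w)%MS = 0.
  by apply: IHk; apply: contra WV; apply: submx_trans; rewrite addsmxSl.
by rewrite /step (eq_avg IH) /avg big1 ?mul0r.
Qed.

(** Running both chains with the same rows keeps the smaller space inside the larger one, and a row
    outside [V] ruins both. *)
Lemma chain_ind_mono k V W0 W : (W0 <= W)%MS -> (W <= V)%MS ->
  chain r k (ind V) W0 <= chain r k (ind V) W.
Proof.
elim: k W0 W => [|k IHk] W0 W W0W WV /=.
  rewrite /ind ler_nat WV; case: (boolP (V <= W0)%MS) => VW0; last by rewrite andbF.
  by rewrite (submx_trans VW0 W0W) leq_b1.
apply: ler_avg => w; have [wV|wV] := boolP (r w <= V)%MS; last first.
  rewrite chain_ind_eq0; first by apply: chain_ge0 => U; apply: ind_ge0.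
  by rewrite addsmx_sub negb_and wV orbT.
by apply: IHk; rewrite ?addsmxS // addsmx_sub WV.
Qed.

(* Of the k rows, k - j do not enlarge the current space: choose which ones;
   each of them falls into V. *)
Lemma chain_exchange k j V W : (W <= V)%MS -> \rank V = (\rank W + j)%N ->
  chain r k (ind V) W <= 'C(k, j)%:R * mass r V ^+ (k - j) * chain r j (ind V) W.
Proof.
set q : R := mass r V; have q0 : 0 <= q by apply: mass_ge0.
have P0 i U : 0 <= chain r i (ind V) U by apply: chain_ge0; apply: ind_ge0.
elim: k j W => [|k IHk] j W WV rkV.
  case: j rkV => [|j] rkV; first by rewrite mul1r mul1r.
  have -> : chain r 0 (ind V) W = 0.
    by rewrite /= /ind WV /=; case: (boolP (V <= W)%MS) => // /mxrankS; lia.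
  by apply: mulr_ge0 => //; rewrite mulr_ge0 ?ler0n ?exprn_ge0.
rewrite chainS.
pose c := 'C(k, j)%:R * q ^+ (k - j) * chain r j (ind V) W.
pose e := if j is i.+1 then 'C(k, i)%:R * q ^+ (k - i) else 0.
have cE : q * c = 'C(k, j)%:R * q ^+ (k.+1 - j) * chain r j (ind V) W.
  rewrite /c !mulrA; congr (_ * _); rewrite [q * _]mulrC -mulrA -exprS.
  by have [jk|kj] := leqP j k; [rewrite subSn | rewrite bin_small ?mul0r].
have c0 : 0 <= c by rewrite !mulr_ge0 ?ler0n ?exprn_ge0.
have e0 : 0 <= e by rewrite /e; case: (j) => // i; rewrite !mulr_ge0 ?ler0n ?exprn_ge0.
(* A row in [V] either lies in [W] and leaves [k] rows for the same [j], or raises the rank and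
   leaves [k] rows for [j.-1]. Pascal's rule adds the two contributions. *)
apply: (@le_trans _ _ (avg (fun w =>
    c * (r w <= V)%MS%:R + e * chain r j.-1 (ind V) (W + r w)%MS))).
  apply: ler_avg => w.
  have [wV|wV] := boolP (r w <= V)%MS; last first.
    rewrite chain_ind_eq0; last by rewrite addsmx_sub negb_and wV orbT.
    by apply: addr_ge0; apply: mulr_ge0; rewrite ?ler0n ?P0.
  rewrite mulr1; have [wW|wW] := boolP (r w <= W)%MS.
    apply: ler_wpDr; first by apply: mulr_ge0; rewrite ?P0.
    apply: le_trans (IHk j W WV rkV).
    by apply: chain_ind_mono => //; rewrite addsmx_sub submx_refl.
  have rkW : \rank (W + r w)%MS = (\rank W).+1 by rewrite mxrank_adds_row wW addn1.
  have WwV : (W + r w <= V)%MS by rewrite addsmx_sub WV.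
  apply: ler_wpDl => //; rewrite /e; case: j rkV {c cE c0 e e0} => [|i] rkV.
    by have := mxrankS WwV; rewrite rkW; lia.
  by apply: IHk => //; rewrite rkW; lia.
rewrite avgD !avgZ mulrC cE /e; case: (j) => [|i].
  by rewrite mul0r addr0 !bin0.
rewrite -[avg _]/(chain r i.+1 (ind V) W) subSS -!mulrDl binS natrD.
by [].
Qed.

(** Many matrices have the same row space; the condition [<<V>>%MS == V] keeps one representative of
    each, so the events summed are disjoint. *)
Lemma sum_ind_le1 (P : pred 'M[F]_n) W :
  \sum_(V | (<<V>>%MS == V) && P V) ind V W <= 1.
Proof.
have key V : <<V>>%MS == V -> (W == V)%MS -> V = <<W>>%MS.
  by move=> /eqP VE /eqmxP/eq_genmx ->; rewrite VE.
have [VP|VP] := boolP (P <<W>>%MS); last first.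
  rewrite big1 ?ler01 // => V /andP[gV PV]; rewrite /ind.
  by case: (boolP (W == V)%MS) => // /(key _ gV) E; rewrite -E PV in VP.
rewrite (bigD1 <<W>>%MS) /= ?genmx_id ?eqxx //= big1 ?addr0.
  by rewrite /ind lern1 leq_b1.
move=> V /andP[/andP[gV PV] VW]; rewrite /ind.
by case: (boolP (W == V)%MS) => // /(key _ gV) E; rewrite -E eqxx in VW.
Qed.

End Exchange.

End Chain.
Arguments mass {R F n O} r U.

Lemma uphalf_bounds n : (n <= 2 * uphalf n <= n.+1)%N.
Proof. by rewrite uphalf_half; have := odd_double_half n; case: (odd n) => /=; lia. Qed.

(** * Swapping rows X for rows Y in a hyperplane *)

Section Swap.
Variables (R : realFieldType) (F : finFieldType) (n : nat).
Variables (OX OY : finType) (rX : OX -> 'rV[F]_n) (rY : OY -> 'rV[F]_n).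
Hypotheses (OX0 : (0 < #|OX|)%N) (OY0 : (0 < #|OY|)%N).
Implicit Types U V W : 'M[F]_n.
Notation massX V := (mass rX V : R).
Notation massY V := (mass rY V : R).
Notation indR := (@ind R F n).

(** While the rank is below [d], the next row lies in [V] but outside the current space with
    probability at least (1 - al) times [massY V]. *)
Lemma chain_independent_in (al : R) d V : 0 <= al <= 1 ->
    (forall W, (\rank W < d)%N -> massY W <= al * massY V) ->
  forall k W, (W <= V)%MS -> (\rank W + k)%N = d ->
  ((1 - al) * massY V) ^+ k <=
    chain rY k (fun U => ((U <= V)%MS && (\rank U == d))%:R) W.
Proof.
move=> /andP[al0 al1] small; elim=> [|k IHk] W WV Wk.
  by rewrite /= WV -Wk addn0 eqxx expr0.
set c := ((1 - al) * massY V) ^+ k in IHk.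
have c0 : 0 <= c by rewrite exprn_ge0 // mulr_ge0 ?subr_ge0 ?mass_ge0.
apply: (@le_trans _ _ (avg (fun w =>
    c * (rY w <= V)%MS%:R + - c * (rY w <= W)%MS%:R))).
  rewrite avgD !avgZ -/(mass rY V) -/(mass rY W) exprSr -/c mulNr -mulrBr.
  rewrite ler_wpM2l // mulrBl mul1r lerD2l lerN2; apply: small; lia.
rewrite chainS; apply: ler_avg => w.
have pos : 0 <= chain rY k (fun U => ((U <= V)%MS && (\rank U == d))%:R) (W + rY w)%MS :> R.
  by apply: chain_ge0 => U; rewrite ler0n.
have [wW|wW] := boolP (rY w <= W)%MS.
  by rewrite (submx_trans wW WV) !mulr1 subrr.
have [wV|wV] := boolP (rY w <= V)%MS; last by rewrite !mulr0 addr0.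
rewrite mulr0 addr0 mulr1; apply: IHk; first by rewrite addsmx_sub WV.
by rewrite mxrank_adds_row wW; lia.
Qed.

(** Let the Y rows come first. Once they span some [W] in [V] of rank [d], starting the X chain from
    [W] instead of 0 only helps, and the exchange inequality charges all X rows but [n.-1 - d] to
    [massX V]. *)
Lemma chain_swap d V : \rank V = n.-1 -> (d <= n.-1)%N ->
  chain rX n (indR V) 0 *
    chain rY d (fun W => ((W <= V)%MS && (\rank W == d))%:R) 0 <=
  'C(n, n.-1 - d)%:R * massX V ^+ (n - (n.-1 - d)) *
    chain rY d (chain rX (n.-1 - d) (indR V)) 0.
Proof.
move=> rkV dn; rewrite -!chainZ; apply: ler_chain => W.
have ge0 : 0 <= 'C(n, n.-1 - d)%:R * massX V ^+ (n - (n.-1 - d)) *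
    chain rX (n.-1 - d) (indR V) W.
  rewrite !mulr_ge0 ?exprn_ge0 ?ler0n ?mass_ge0 //.
  by apply: chain_ge0 => U; apply: ind_ge0.
have [WV|] := boolP (W <= V)%MS; last by rewrite mulr0.
have [/eqP rkW|] := boolP (\rank W == d); last by rewrite mulr0.
rewrite mulr1; apply: (@le_trans _ _ (chain rX n (indR V) W)).
  by apply: chain_ind_mono => //; apply: sub0mx.
by apply: chain_exchange => //; rewrite rkV rkW subnKC.
Qed.

Variables (bY eps0 : R).
Hypothesis mass3 : forall U, massX U <= 3^-1 ^+ (n - \rank U).
Hypothesis bY01 : 0 < bY <= 1.
Hypothesis massYb : forall W, massY W <= bY ^+ (n - \rank W).
Hypothesis eps01 : 0 <= eps0 <= 1 / 2.
Hypothesis massXY : forall V, \rank V = n.-1 ->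
  massX V <= bY ^+ uphalf n + eps0 * massY V.
Hypothesis n0 : (0 < n)%N.
Notation u := (uphalf n).
(** One factor 49/50 pays for absorbing the term [bY ^+ u] of [massXY], the other for taking [al] =
    1/50 in [chain_independent_in]. *)
Let eps1 : R := eps0 / (49 / 50) ^+ 2.

(** If [massX V] is at most 50 bY^u, charging a single dependent row suffices, with n choices for
    it. Otherwise [massX V] is at most a small multiple of [massY V]: with [u.-1] independent Y rows
    swapped in, [u] of the X rows are charged, and the probability of the Y rows cancels the powers
    of [massY V]. *)
Lemma chain_hyperplane V : \rank V = n.-1 ->
  chain rX n (indR V) 0 <=
  n%:R * (50 * bY ^+ u) * chain rX n.-1 (indR V) 0 +
  4 ^+ u * eps1 ^+ u * chain rY u.-1 (chain rX (n.-1 - u.-1) (indR V)) 0.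
Proof.
move=> rkV.
have chX0 k W : 0 <= chain rX k (indR V) W.
  by apply: chain_ge0 => U; apply: ind_ge0.
set E := chain rY _ _ _.
have E0 : 0 <= E by apply: chain_ge0 => U; apply: chX0.
have bu0 : 0 < bY ^+ u by rewrite exprn_gt0 //; case/andP: bY01.
have [e0 e1] := andP eps01.
have e10 : 0 <= eps1 by rewrite divr_ge0 // exprn_ge0; (clear rkV; lra).
have [small|big] := leP (massX V) (50 * bY ^+ u).
  apply: ler_wpDr; first by rewrite !mulr_ge0 // exprn_ge0.
  apply: le_trans (@chain_exchange _ _ _ _ rX OX0 n n.-1 V 0 _ _) _.
  - exact: sub0mx.
  - by rewrite mxrank0 rkV.
  rewrite -bin_sub ?leq_pred // (_ : n - n.-1 = 1)%N ?bin1 ?expr1; last lia.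
  by rewrite ler_wpM2r // ler_wpM2l.
apply: ler_wpDl; first by rewrite !mulr_ge0 // ltW.
have u0 : (0 < u)%N by lia.
have un : (u.-1 <= n.-1)%N by lia.
set q := massX V in big *; set q' := massY V.
have q'0 : 0 <= q' by apply: mass_ge0.
have q'1 : q' <= 1 by apply: mass_le1.
have qq' : q <= eps1 * (49 / 50) * q'.
  have := massXY rkV; rewrite -/q -/q' => le.
  have -> : eps1 * (49 / 50) = eps0 * (50 / 49) by rewrite /eps1; field.
  by clear rkV; lra.
have q'u : 50 * bY ^+ u <= q'.
  apply: le_trans (ltW big) _; apply: le_trans qq' _.
  rewrite ler_piMl // /eps1.
  have -> : eps0 / (49 / 50) ^+ 2 * (49 / 50) = eps0 * (50 / 49) by field.
  by clear rkV; lra.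
have q0 : 0 <= q by apply: mass_ge0.
set A := chain rY u.-1 (fun W => ((W <= V)%MS && (\rank W == u.-1))%:R) 0 : R.
have Alb : ((49 / 50) * q') ^+ u.-1 <= A.
  have -> : 49 / 50 = 1 - 1 / 50 :> R by clear rkV; lra.
  apply: chain_independent_in; rewrite ?mxrank0 ?sub0mx //; first by (clear rkV; lra).
  (* A space of rank below [u.-1] has codimension at least [u], so its mass is at most 1/50 of
     [massY V]. *)
  move=> W Wu; apply: le_trans (massYb W) _.
  apply: le_trans (_ : bY ^+ u <= _); last by rewrite -/q'; (clear rkV; lra).
  case/andP: bY01 => b0 b1; rewrite ler_wiXn2l ?(ltW b0) //.
  by move: (\rank W) Wu => x; have := uphalf_bounds n; clear -n0; lia.
have A0 : 0 < A.
  apply: lt_le_trans Alb; rewrite exprn_gt0 //; clear rkV; nra.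
have := chain_swap rkV un; rewrite -/A -/E -/q.
have -> : (n - (n.-1 - u.-1))%N = u by clear -n0; lia.
move=> sw; rewrite -(ler_pM2r A0); apply: le_trans sw _.
have qu : q ^+ u <= eps1 ^+ u * A.
  rewrite -(prednK u0) !exprS.
  apply: (@le_trans _ _ (eps1 * (eps1 ^+ u.-1 * ((49 / 50) * q') ^+ u.-1))).
    rewrite -exprMn mulrA; apply: ler_pM => //; first exact: exprn_ge0.
      apply: le_trans qq' _; rewrite -mulrA ler_piMr //; (clear rkV; lra).
    have c0 : (0 : R) <= 49 / 50 by clear rkV; lra.
    by apply: lerXn2r; rewrite ?nnegrE // mulr_ge0 ?(mulr_ge0 e10).
  by rewrite -[leRHS]mulrA ler_wpM2l // ler_wpM2l // exprn_ge0.
have C4 : 'C(n, n.-1 - u.-1)%:R <= 4 ^+ u :> R.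
  rewrite -natrX ler_nat; apply: leq_trans (_ : 2 ^ n <= _)%N.
    have := Pascal 1 1 n; rewrite addn1 => ->.
    rewrite (bigD1 (inord (n.-1 - u.-1))) //= !exp1n inordK; last by clear; lia.
    by rewrite muln1 muln1 leq_addr.
  rewrite -[4%N]/(2 ^ 2)%N -expnM leq_exp2l //; have := uphalf_bounds n; clear; lia.
rewrite [leRHS](_ : _ = 4 ^+ u * (eps1 ^+ u * A) * E); last by ring.
by rewrite ler_wpM2r // ler_pM // ?ler0n // exprn_ge0.
Qed.

(** An outcome of corank one determines its hyperplane. The chain factors in [chain_hyperplane] are
    probabilities of events that are disjoint for distinct [V], so their sums over [V] are at most
    1. *)
Lemma singular_chain_bound :
  chain rX n (fun U => (\rank U < n)%N%:R) 0 <=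
  2 * (n%:R * (50 * bY ^+ u) + 4 ^+ u * eps1 ^+ u).
Proof.
have hc := singular_le_corank1 OX0 mass3 (k := n) (W := 0).
apply: le_trans (hc _) _; first by rewrite mxrank0.
rewrite ler_wpM2l //.
pose P V := (<<V>>%MS == V) && (\rank V == n.-1).
have sum1 (O : finType) (r : O -> 'rV[F]_n) k (W : 'M[F]_n) : (0 < #|O|)%N ->
    \sum_(V | P V) chain r k (indR V) W <= 1.
  move=> O0; rewrite -chain_sum -[leRHS](chain_const r O0 k 1 W).
  by apply: ler_chain => U; apply: sum_ind_le1.
apply: (@le_trans _ _ (\sum_(V | P V) chain rX n (indR V) 0)).
  rewrite -chain_sum; apply: ler_chain => U.
  have [rkU|_] := boolP (\rank U == n.-1); last by rewrite sumr_ge0 // => V _; exact: ind_ge0.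
  rewrite (bigD1 <<U>>%MS) /P ?genmx_id ?eqxx ?mxrank_gen //=.
  rewrite /ind !genmxE submx_refl ler_wpDr // sumr_ge0 // => V _; exact: ler0n.
apply: (@le_trans _ _ (\sum_(V | P V) (n%:R * (50 * bY ^+ u) * chain rX n.-1 (indR V) 0 +
  4 ^+ u * eps1 ^+ u * chain rY u.-1 (chain rX (n.-1 - u.-1) (indR V)) 0))).
  by apply: ler_sum => V /andP[_ /eqP]; apply: chain_hyperplane.
have [b0 _] := andP bY01; have [e0 _] := andP eps01.
rewrite big_split /= -!mulr_sumr; apply: lerD.
  by rewrite ler_piMr ?sum1 // !mulr_ge0 // exprn_ge0 // ltW.
rewrite ler_piMr //.
  by rewrite mulr_ge0 ?exprn_ge0 // divr_ge0 // exprn_ge0; lra.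
rewrite -chain_sum -[leRHS](chain_const rY OY0 u.-1 1 (0 : 'M[F]_n)).
by apply: ler_chain => U; apply: sum1.
Qed.

End Swap.

(** * Odlyzko's lemma *)

Section Entries.
Variables (R : realFieldType) (F : finFieldType) (n : nat).
Variables (S : finType) (e : S -> F).

Definition iid_row (f : {ffun 'I_n -> S}) : 'rV[F]_n := \row_j e (f j).

Definition atom (c : F) : R := avg (fun s => (e s == c)%:R).

Definition resample (f : {ffun 'I_n -> S}) j s : {ffun 'I_n -> S} :=
  [ffun i => if i == j then s else f i].

Lemma resampleK f j s : resample (resample f j s) j (f j) = f.
Proof. by apply/ffunP => i; rewrite !ffunE; case: eqP => // ->. Qed.

(** Swapping [f j] with the fresh value [s] is an involution on pairs, so drawing one coordinate
    afresh preserves the uniform distribution. *)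
Lemma sum_resample (g : {ffun 'I_n -> S} -> R) j :
  #|S|%:R * (\sum_f g f) = \sum_f \sum_s g (resample f j s).
Proof.
rewrite pair_big /=.
pose h (q : {ffun 'I_n -> S} * S) := (resample q.1 j q.2, q.1 j).
have hK : involutive h.
  by move=> [f s]; rewrite /h /= resampleK; congr (_, _); rewrite ffunE eqxx.
rewrite (reindex h) /=; last by exists h => q _; apply: hK.
rewrite (eq_bigr (fun q => g q.1)); last by move=> [f s] _; rewrite /h /= resampleK.
rewrite -(pair_big xpredT xpredT (fun f (s : S) => g f)) /= mulr_sumr.
by apply: eq_bigr => f _; rewrite sumr_const mulr_natl.
Qed.

Lemma iid_row_resample f j s :
  iid_row (resample f j s) = iid_row f + (e s - e (f j)) *: delta_mx 0 j.
Proof.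
apply/rowP => i; rewrite !mxE !ffunE eqxx /=.
by case: (eqVneq i j) => [->|]; rewrite ?mulr1 ?mulr0 ?addr0 // addrC subrK.
Qed.

Hypothesis S0 : (0 < #|S|)%N.
Variable beta : R.
Hypothesis beta0 : 0 <= beta.
Hypothesis atom_beta : forall c, atom c <= beta.

Lemma card_iid_gt0 : (0 < #|{ffun 'I_n -> S}|)%N.
Proof. by rewrite card_ffun expn_gt0 S0. Qed.

(* Odlyzko's argument: a coordinate vector outside U makes that coordinate of
   a row in U a function of the other ones. *)
Lemma odlyzko (U : 'M[F]_n) : mass iid_row U <= beta ^+ (n - \rank U).
Proof.
have [k] : {k | k = (n - \rank U)%N} by exists (n - \rank U)%N.
elim: k U => [|k IHk] U kE; rewrite -kE.
  by rewrite expr0; apply: mass_le1; apply: card_iid_gt0.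
have [j jU] : exists j, ~~ ((delta_mx 0 j : 'rV[F]_n) <= U)%MS.
  apply/existsP; apply: contraPT kE; rewrite negb_exists => /forallP allU.
  have /mxrankS : (1%:M <= U)%MS.
    apply/row_subP => i; rewrite rowE mulmx1.
    by have := allU i; rewrite negbK.
  by rewrite mxrank1; move: (\rank U) => x; lia.
set U' := (U + (delta_mx 0 j : 'rV[F]_n))%MS.
have rk' : \rank U' = (\rank U).+1 by rewrite mxrank_adds_row jU addn1.
have kE' : k = (n - \rank U')%N.
  by rewrite rk'; move: (\rank U) kE => x; clear; lia.
apply: (@le_trans _ _ (beta * mass iid_row U')); last first.
  by rewrite exprS ler_wpM2l // kE' IHk.
rewrite /mass /avg mulrA ler_wpM2r ?invr_ge0 ?ler0n //.
have S0' : 0 < #|S|%:R :> R by rewrite ltr0n.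
rewrite -(ler_pM2l S0') (sum_resample _ j) mulrA mulr_sumr; apply: ler_sum => f _.
pose G s := (iid_row (resample f j s) <= U)%MS.
have GU' s : G s -> (iid_row f <= U')%MS.
  rewrite /G iid_row_resample => Gs.
  rewrite -[iid_row f](addrK ((e s - e (f j)) *: delta_mx 0 j)) /U'.
  by rewrite addmx_sub_adds // eqmx_opp scalemx_sub.
have [s0 Gs0|G0] := pickP G; last first.
  by rewrite big1 ?mulr_ge0 ?ler0n // => s _; rewrite -/(G s) G0.
rewrite (GU' _ Gs0) mulr1.
(* Two resampled rows differ by a multiple of [delta_mx 0 j]; if both lie in [U] with distinct
   entries at [j], that vector lies in [U] too. *)
have Ge s : G s -> e s = e s0.
  move=> Gs; apply/eqP; rewrite -subr_eq0; apply: contraNT jU => ne.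
  have : (iid_row (resample f j s) - iid_row (resample f j s0) <= U)%MS.
    by rewrite addmx_sub // eqmx_opp.
  rewrite !iid_row_resample opprD addrACA subrr add0r -scalerBl opprB addrA subrK.
  by move=> /(scalemx_sub (e s - e s0)^-1); rewrite scalerA mulVf // scale1r.
apply: (@le_trans _ _ (\sum_s (e s == e s0)%:R)).
  apply: ler_sum => s _; rewrite -/(G s) ler_nat.
  by case: (boolP (G s)) => // /Ge ->; rewrite eqxx.
by have := atom_beta (e s0); rewrite /atom /avg ler_pdivrMr // mulrC.
Qed.

End Entries.
Arguments iid_row {F} n {S} e f.
Arguments atom {R F S} e c.

(** * Growth of balls and comparison of character sums *)

Lemma cauchy_schwarz_sum (R : realDomainType) (I : finType) (x y : I -> R) :
  (\sum_i x i * y i) ^+ 2 <= (\sum_i x i ^+ 2) * (\sum_i y i ^+ 2).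
Proof.
set A := \sum_i x i ^+ 2; set B := \sum_i y i ^+ 2; set C := \sum_i x i * y i.
have : 0 <= \sum_i \sum_j (x i * y j - x j * y i) ^+ 2.
  by apply: sumr_ge0 => i _; apply: sumr_ge0 => j _; apply: sqr_ge0.
rewrite (_ : \sum_i _ = A * B + A * B - (C ^+ 2 + C ^+ 2)); first by lra.
rewrite expr2 /A /B /C.
rewrite {2}[(\sum_i x i ^+ 2) * _]mulrC !mulr_suml -!big_split -sumrB /=.
apply: eq_bigr => i _; rewrite !mulr_sumr -!big_split -sumrB /=.
by apply: eq_bigr => j _; ring.
Qed.

Lemma minkowski_sum (R : rcfType) (I : finType) (x y : I -> R) :
  Num.sqrt (\sum_i (x i + y i) ^+ 2) <=
  Num.sqrt (\sum_i x i ^+ 2) + Num.sqrt (\sum_i y i ^+ 2).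
Proof.
have sq0 (z : I -> R) : 0 <= \sum_i z i ^+ 2.
  by apply: sumr_ge0 => i _; apply: sqr_ge0.
set A := \sum_i x i ^+ 2; set B := \sum_i y i ^+ 2; set C := \sum_i x i * y i.
have CAB : C <= Num.sqrt A * Num.sqrt B.
  rewrite -sqrtrM ?sq0 //; apply: le_trans (ler_norm C) _.
  by rewrite -sqrtr_sqr ler_wsqrtr // cauchy_schwarz_sum.
rewrite -(@ler_pXn2r _ 2) ?nnegrE ?addr_ge0 ?sqrtr_ge0 //.
rewrite sqrrD !sqr_sqrtr ?sq0 //.
rewrite (_ : \sum_i _ = A + C *+ 2 + B); first by lra.
rewrite /A /B /C -sumrMnl -!big_split /=; apply: eq_bigr => i _; ring.
Qed.

Section Ball.
Variables (R : rcfType) (V : finZmodType) (rho : V -> R).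
Hypothesis rho0 : rho 0 = 0.
Hypothesis rhoN : forall x, rho (- x) = rho x.
Hypothesis rhoD : forall x y, rho (x + y) <= rho x + rho y.

Definition ball (D : R) : {set V} := [set x | rho x <= D].

(* The multiples of x leave the ball of radius 3rD by steps of length at most
   D, so r of them are the centers of disjoint translates of the ball of
   radius D. *)
Lemma ball_growth D r x k : rho x <= D -> 3 * r%:R * D < rho (x *+ k) ->
  (r * #|ball D| <= #|ball (3 * r%:R * D)|)%N.
Proof.
move=> xD far.
have rho_ge0 y : 0 <= rho y.
  have := rhoD y (- y); rewrite subrr rho0 rhoN; lra.
have D0 : 0 <= D by apply: le_trans xD.
have ex (i : 'I_r) : exists m, 3 * (i : nat)%:R * D < rho (x *+ m).
  exists k; apply: le_lt_trans far; rewrite ler_wpM2r // ler_wpM2l // ler_nat.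
  exact: ltnW.
(* The first multiple of [x] beyond 3iD. By minimality it overshoots by at most [D], so [rho]
   differs by more than 2D at different centers. *)
pose c i := x *+ ex_minn (ex i).
have c_gt (i : 'I_r) : 3 * (i : nat)%:R * D < rho (c i) by rewrite /c; case: ex_minnP.
have c_le (i : 'I_r) : rho (c i) <= 3 * (i : nat)%:R * D + D.
  rewrite /c; case: ex_minnP => [[|m]] gtm minm.
    by rewrite mulr0n rho0 addr_ge0 ?mulr_ge0 ?ler0n.
  rewrite mulrSr; apply: le_trans (rhoD _ _) _; apply: lerD => //.
  by rewrite leNgt; apply/negP => /minm; rewrite ltnn.
pose g (q : 'I_r * V) := c q.1 + q.2.
have sep (i j : 'I_r) y z : y \in ball D -> z \in ball D -> c i + y = c j + z ->
    (j <= i)%N.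
  rewrite !inE => yD zD E; rewrite leqNgt; apply/negP => ij.
  have : rho (c j) <= rho (c i) + rho y + rho z.
    have -> : c j = c i + y - z by rewrite E addrK.
    by apply: le_trans (rhoD _ _) _; rewrite rhoN lerD2r.
  have := c_gt j; have := c_le i.
  have : (i : nat)%:R + 1 <= (j : nat)%:R :> R by rewrite natr1 ler_nat.
  by nra.
have ginj : {in setX [set: 'I_r] (ball D) &, injective g}.
  move=> [i y] [j z]; rewrite !in_setX /= => /andP[_ yD] /andP[_ zD] E.
  have ij : i = j.
    by apply/val_inj/eqP; rewrite eqn_leq (sep _ _ _ _ yD zD E) (sep _ _ _ _ zD yD (esym E)).
  by move: E; rewrite /g ij /= => /addrI ->.
rewrite -[r in leqLHS]card_ord -cardsT -cardsX -(card_in_imset ginj).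
apply/subset_leq_card/subsetP => z /imsetP[[i y]].
rewrite in_setX /= !inE => /= yD ->; rewrite /g /=.
apply: le_trans (rhoD _ _) _.
have := c_le i.
have : (i : nat)%:R + 1 <= r%:R :> R by rewrite natr1 ler_nat.
by nra.
Qed.

End Ball.

Lemma ler_prod_weierstrass (R : realDomainType) (I : Type) (s : seq I) (b y : I -> R) :
  (forall i, 0 <= b i) -> (forall i, 0 <= y i) -> (forall i, 1 - y i <= b i) ->
  1 - \sum_(i <- s) y i <= \prod_(i <- s) b i.
Proof.
move=> b0 y0 yb; elim: s => [|i s IHs]; first by rewrite !big_nil subr0.
rewrite !big_cons.
have P0 : 0 <= \prod_(j <- s) b j by apply: prodr_ge0.
have S0 : 0 <= \sum_(j <- s) y j by apply: sumr_ge0.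
move: P0 S0 IHs (b0 i) (y0 i) (yb i).
set P := \prod_(j <- s) _; set S := \sum_(j <- s) _ => P0 S0 IH bi yi ybi.
have [S1|S1] := leP (y i + S) 1; last by nra.
by apply: le_trans (_ : (1 - y i) * (1 - S) <= _); nra.
Qed.

(** Stands in for the bound of a product of factors 1 - x_i by exp(-S), S being the sum of the x_i,
    with exp(S) weakened to 1 + S. *)
Lemma prod_mul_succ_sum_le1 (R : realDomainType) (I : Type) (s : seq I) (a x : I -> R) :
  (forall i, 0 <= a i) -> (forall i, 0 <= x i) -> (forall i, a i <= 1 - x i) ->
  (\prod_(i <- s) a i) * (1 + \sum_(i <- s) x i) <= 1.
Proof.
move=> a0 x0 ax; elim: s => [|i s IHs]; first by rewrite !big_nil; lra.
rewrite !big_cons.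
have P0 : 0 <= \prod_(j <- s) a j by apply: prodr_ge0.
have S0 : 0 <= \sum_(j <- s) x j by apply: sumr_ge0.
move: P0 S0 IHs (a0 i) (x0 i) (ax i).
set P := \prod_(j <- s) _; set S := \sum_(j <- s) _ => P0 S0 IH ai xi axi.
have h1 : a i * (1 + x i) <= 1 by nra.
have h2 : 1 + (x i + S) <= (1 + x i) * (1 + S) by nra.
apply: (@le_trans _ _ ((a i * (1 + x i)) * (P * (1 + S)))).
  rewrite (_ : _ * _ * (_ * _) = a i * P * ((1 + x i) * (1 + S))); last by ring.
  by rewrite ler_wpM2l // mulr_ge0.
by rewrite -[leRHS]mulr1 ler_pM // mulr_ge0 //; lra.
Qed.

Section Compare.
Variables (R : rcfType) (p : nat) (n : nat) (nrm a b : 'F_p -> R).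
Variable v : 'I_n -> 'F_p.
Hypothesis p_pr : prime p.
Hypothesis nrm0 : nrm 0 = 0.
Hypothesis nrm_ge0 : forall s, 0 <= nrm s.
Hypothesis nrmN : forall s, nrm (- s) = nrm s.
Hypothesis nrmD : forall s t, nrm (s + t) <= nrm s + nrm t.
Variables (lam kap th D : R) (r : nat).
Hypothesis lam0 : 0 < lam.
Hypothesis kap0 : 0 <= kap.
Hypothesis kap_lam : 2 * kap <= lam.
Hypothesis th0 : 0 < th.
Hypothesis D0 : 0 <= D.
Hypothesis r0 : (0 < r)%N.
Hypothesis lamD : 1 <= lam * th ^+ 2 * D ^+ 2.
Hypothesis kapD : kap * (3 * r%:R * D) ^+ 2 <= 1 / 50.
Hypothesis a01 : forall s, 0 <= a s <= 1.
Hypothesis a_nrm : forall s, th ^+ 2 < a s -> a s <= 1 - lam * nrm s ^+ 2.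
Hypothesis b_th : forall s, th <= b s.
Hypothesis b_nrm : forall s, 1 - kap * nrm s ^+ 2 <= b s.

(** Here [a] plays the modulus of the Fourier coefficient of an entry of X, [b] the coefficient of
    an entry of Y, [nrm] the distance of a character value to 1, and [v] the normal vector. The
    balls of radius [D] and [3 * r%:R * D] for this seminorm are compared below. *)
Definition spread (xi : 'F_p) : R := Num.sqrt (\sum_i nrm (xi * v i) ^+ 2).

Let prA xi := \prod_i a (xi * v i).
Let prB xi := \prod_i b (xi * v i).

Lemma spread_sqr xi : spread xi ^+ 2 = \sum_i nrm (xi * v i) ^+ 2.
Proof. by rewrite sqr_sqrtr // sumr_ge0 // => i _; apply: sqr_ge0. Qed.

Lemma spread0 : spread 0 = 0.
Proof.
rewrite /spread big1 ?sqrtr0 // => i _; by rewrite mul0r nrm0 expr0n.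
Qed.

Lemma spreadN xi : spread (- xi) = spread xi.
Proof. by rewrite /spread; under eq_bigr do rewrite mulNr nrmN. Qed.

Lemma spreadD xi eta : spread (xi + eta) <= spread xi + spread eta.
Proof.
apply: le_trans (minkowski_sum _ _); apply: ler_wsqrtr; apply: ler_sum => i _.
by rewrite mulrDl lerXn2r ?nnegrE ?addr_ge0.
Qed.

Lemma b_gt0 s : 0 < b s. Proof. exact: lt_le_trans (b_th s). Qed.

(** With N the square of [nrm s]: a large [a s] is at most 1 - lam N <= 1 - 2 kap N <= (1 - kap
    N)^2, and the middle term is negative if kap N > 1; a small one is at most th^2. *)
Lemma a_le_sqr_b s : a s <= b s ^+ 2.
Proof.
have b0 := b_gt0 s.
have [small|big] := leP (a s) (th ^+ 2).
  by apply: le_trans small _; rewrite lerXn2r ?nnegrE ?(ltW b0) ?(ltW th0).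
have an := a_nrm big; have bn := b_nrm s.
have N0 : 0 <= nrm s ^+ 2 by apply: sqr_ge0.
set N := nrm s ^+ 2 in an bn N0.
have kl : 2 * kap * N <= lam * N by rewrite ler_wpM2r.
have [le|lt] := leP (kap * N) 1; last first.
  by apply: le_trans (sqr_ge0 _); lra.
apply: (@le_trans _ _ ((1 - kap * N) ^+ 2)); first by nra.
by rewrite lerXn2r ?nnegrE ?subr_ge0 // ltW.
Qed.

Lemma prodA_le1 xi : prA xi <= 1.
Proof. by apply: prodr_ile1 => i _; apply: a01. Qed.

Lemma prodB_ge0 xi : 0 <= prB xi.
Proof. by apply: prodr_ge0 => i _; apply/ltW/b_gt0. Qed.

(** The product A is at most th^2 and at most B^2, and the geometric mean of these bounds is th
    B. *)
Lemma prodA_small xi : prA xi <= th ^+ 2 -> prA xi <= th * prB xi.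
Proof.
move=> small.
have : prA xi <= prB xi ^+ 2.
  rewrite /prB -prodrXl; apply: ler_prod => i _.
  by rewrite a_le_sqr_b andbT; case/andP: (a01 (xi * v i)).
have := prodB_ge0 xi; set A := prA xi in small *; set B := prB xi => B0 AB.
have [le|lt] := leP B th.
  by apply: le_trans AB _; rewrite expr2 ler_wpM2r.
by apply: le_trans small _; rewrite expr2 ler_wpM2l // ltW.
Qed.

(** All factors are at most 1, so each exceeds th^2 and [a_nrm] applies to it. The product
    inequality then bounds lam th^2 times the squared spread by 1, and [lamD] converts this into the
    radius. *)
Lemma prodA_big xi : th ^+ 2 < prA xi -> spread xi <= D.
Proof.
move=> big.
have big_j j : th ^+ 2 < a (xi * v j).
  apply: lt_le_trans big _; rewrite /prA (bigD1 j) //=.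
  rewrite ler_piMr //; first by case/andP: (a01 (xi * v j)).
  by apply: prodr_ile1 => i _; apply: a01.
have := @prod_mul_succ_sum_le1 R 'I_n (index_enum 'I_n) (fun i => a (xi * v i))
  (fun i => lam * nrm (xi * v i) ^+ 2).
rewrite -mulr_sumr -spread_sqr -/(prA xi) => le.
have {}le : prA xi * (1 + lam * spread xi ^+ 2) <= 1.
  apply: le => i; first by case/andP: (a01 (xi * v i)).
    by rewrite mulr_ge0 ?sqr_ge0 // ltW.
  exact: a_nrm.
have s0 : 0 <= spread xi by apply: sqrtr_ge0.
rewrite leNgt; apply/negP => lt.
have sD : D ^+ 2 < spread xi ^+ 2 by rewrite ltrXn2r ?nnegrE.
have th2 : 0 < th ^+ 2 by apply: exprn_gt0.
move: big le lamD sD th2.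
set A := prA xi; set T := th ^+ 2; set X := spread xi ^+ 2; set D2 := D ^+ 2.
move=> big le lD sD th2.
have h1 : T * (lam * X) <= A * (1 + lam * X) - A.
  have : 0 <= lam * X by rewrite mulr_ge0 ?sqr_ge0 // ltW.
  by nra.
have h2 : T * (lam * D2) < T * (lam * X) by rewrite ltr_pM2l // ltr_pM2l.
by nra.
Qed.

Lemma prodB_near1 xi : spread xi <= 3 * r%:R * D -> 49 / 50 <= prB xi.
Proof.
move=> le; apply: le_trans (_ : 1 - kap * spread xi ^+ 2 <= _).
  have : kap * spread xi ^+ 2 <= kap * (3 * r%:R * D) ^+ 2.
    by rewrite ler_wpM2l // lerXn2r ?nnegrE ?sqrtr_ge0 // !mulr_ge0 ?ler0n.
  have := kapD; set x := kap * _; set y := kap * _; lra.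
rewrite spread_sqr mulr_sumr.
apply: (@ler_prod_weierstrass R 'I_n (index_enum 'I_n) (fun i => b (xi * v i))).
- by move=> i; apply/ltW/b_gt0.
- by move=> i; rewrite mulr_ge0 ?sqr_ge0.
- by move=> i; apply: b_nrm.
Qed.

(** Outside the small ball [prA] is at most th [prB]. Inside it is at most 1, and the small ball has
    at most 1/r of the elements of the large one, where [prB] is at least 49/50. A small ball
    reduced to 0 gives the term 1/p; a large ball equal to F_p gives the second alternative. *)
Lemma char_sum_compare :
  let PX := (\sum_xi prA xi) / p%:R in
  let PY := (\sum_xi prB xi) / p%:R in
  PX <= 1 / p%:R + (th + 50 / 49 / r%:R) * PY \/ 49 / 50 <= PY.
Proof.
move=> PX PY.
have p0 : 0 < p%:R :> R by rewrite ltr0n prime_gt0.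
have rr0 : 0 < r%:R :> R by rewrite ltr0n.
have prB0 : 0 <= \sum_xi prB xi by apply: sumr_ge0 => xi _; apply: prodB_ge0.
have PY0 : 0 <= PY by rewrite divr_ge0 // ltW.
set BD := ball spread D; set BR := ball spread (3 * r%:R * D).
have lbY : #|BR|%:R * (49 / 50) <= \sum_xi prB xi.
  rewrite (bigID [in BR]) /= ler_wpDr //.
    by apply: sumr_ge0 => xi _; apply: prodB_ge0.
  rewrite mulr_natl -sumr_const; apply: ler_sum => xi.
  by rewrite inE; apply: prodB_near1.
have ubX : \sum_xi prA xi <= #|BD|%:R + th * \sum_xi prB xi.
  rewrite mulr_sumr -[#|BD|%:R]sumr_const [\sum_(i in _) _]big_mkcond -big_split /=.
  apply: ler_sum => xi _; rewrite inE.
  have B0 := prodB_ge0 xi.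
  case: (leP (spread xi) D) => [_|far].
    by apply: le_trans (prodA_le1 xi) _; rewrite lerDl mulr_ge0 // ltW.
  rewrite add0r; apply: prodA_small; rewrite leNgt; apply/negP => /prodA_big.
  by rewrite leNgt far.
have [full|/subsetPn[eta _ far]] := boolP ([set: 'F_p] \subset BR).
  right; rewrite /PY ler_pdivlMr // mulrC; apply: le_trans lbY.
  rewrite ler_wpM2r //; first by lra.
  rewrite ler_nat; apply: (@leq_trans #|[set: 'F_p]|).
    by rewrite cardsT card_Fp.
  exact: subset_leq_card.
left.
have BDle : #|BD|%:R <= 1 + (50 / 49 / r%:R) * \sum_xi prB xi.
  have [xi /andP[xi0 xiD]|no] := pickP (fun xi : 'F_p => (xi != 0) && (xi \in BD)).
    apply: ler_wpDl => //.
    have grow : (r * #|BD| <= #|BR|)%N.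
      (* Modulo a prime, [eta] is a multiple of the nonzero [xi]. *)
      apply: (@ball_growth R 'F_p spread spread0 spreadN spreadD D r xi (val (eta / xi))).
        by rewrite inE in xiD.
      have -> : xi *+ val (eta / xi) = eta by rewrite -mulr_natr natr_Zp mulrC divfK.
      by move: far; rewrite inE -ltNge.
    rewrite -(ler_pM2l rr0) mulrA -natrM.
    have -> : r%:R * (50 / 49 / r%:R) = 50 / 49 :> R by field; rewrite gt_eqF.
    apply: (@le_trans _ _ #|BR|%:R); first by rewrite ler_nat.
    by lra.
  apply: ler_wpDr.
    by rewrite mulr_ge0 // !mulr_ge0 ?invr_ge0 // ltW.
  rewrite -[1 in leRHS]/(1%:R) ler_nat -(cards1 (0 : 'F_p)) subset_leq_card //.
  apply/subsetP => xi xiD; rewrite inE; apply: contraFT (no xi) => xi0.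
  by rewrite xi0 xiD.
rewrite /PX /PY ler_pdivrMr //.
set c := 50 / 49 / r%:R in BDle *; set SB := \sum_xi prB xi in ubX BDle *.
rewrite (_ : _ * p%:R = 1 + (th + c) * SB); last by field; rewrite gt_eqF.
by rewrite mulrDl; lra.
Qed.

End Compare.

(** * Characters of F_p *)

Section Modulus.
Variable R : rcfType.
Implicit Types z w : R[i].
Local Notation mod := (@Normc.normc R).

Lemma normcX z k : mod (z ^+ k) = mod z ^+ k.
Proof.
by elim: k => [|k IHk]; rewrite ?expr0 ?Normc.normc1 // !exprS Normc.normcM IHk.
Qed.

Lemma sqr_normcE z : mod z ^+ 2 = complex.Re z ^+ 2 + complex.Im z ^+ 2.
Proof. by case: z => x y /=; rewrite sqr_sqrtr // addr_ge0 ?sqr_ge0. Qed.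

Lemma normc_ge0 z : 0 <= mod z.
Proof. by case: z => x y; apply: sqrtr_ge0. Qed.

Lemma normc_real (x : R) : 0 <= x -> mod (x%:C)%C = x.
Proof. by move=> x0; rewrite /= expr0n addr0 sqrtr_sqr ger0_norm. Qed.

Lemma normc_nat k : mod k%:R = k%:R.
Proof.
have -> : k%:R = ((k%:R : R)%:C)%C by rewrite rmorph_nat.
by rewrite normc_real ?ler0n.
Qed.

Lemma le_normc_sum (I : Type) (s : seq I) (P : pred I) (f : I -> R[i]) :
  mod (\sum_(i <- s | P i) f i) <= \sum_(i <- s | P i) mod (f i).
Proof.
elim/big_ind2: _ => [|x1 x2 y1 y2 h1 h2|//]; first by rewrite Normc.normc0.
by apply: le_trans (le_normcD _ _) _; apply: lerD.
Qed.

Lemma normc_prod (I : Type) (s : seq I) (f : I -> R[i]) :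
  mod (\prod_(i <- s) f i) = \prod_(i <- s) mod (f i).
Proof. by elim/big_rec2: _ => [|i x y _ <-]; rewrite ?Normc.normc1 ?Normc.normcM. Qed.

End Modulus.

Local Notation mod := (@Normc.normc _).

(** Algebraic closedness of [R[i]] gives a root of 1 + X + ... + X^(p-1); it is not 1, where this
    polynomial takes the value p. *)
Lemma root_of_unity_neq1 (R : rcfType) p : prime p ->
  exists2 z : R[i], z ^+ p = 1 & z != 1.
Proof.
move=> /prime_gt1; case: p => [|[|p]] // _.
have [z zE] := @solve_monicpoly R[i] p.+1 (fun=> -1) isT.
have sum0 : \sum_(i < p.+2) z ^+ i = 0.
  rewrite big_ord_recr /= zE -big_split /= big1 // => i _.
  by rewrite mulN1r subrr.
exists z; first by apply/eqP; rewrite -subr_eq0 subrX1 sum0 mulr0.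
apply/negP => /eqP z1; move/eqP: sum0; rewrite z1.
under eq_bigr do rewrite expr1n.
by rewrite sumr_const card_ord pnatr_eq0.
Qed.

Section Characters.
Variables (R : rcfType) (p : nat) (z : R[i]).
Hypotheses (p_pr : prime p) (zp : z ^+ p = 1) (z1 : z != 1).

Definition chi (s : 'F_p) : R[i] := z ^+ s.

Lemma chiD s t : chi (s + t) = chi s * chi t.
Proof.
rewrite /chi -exprD -[in RHS](expr_mod _ zp) /=.
by congr (_ ^+ (_ %% _)); rewrite Fp_cast.
Qed.

Lemma chi0 : chi 0 = 1. Proof. exact: expr0. Qed.

Lemma chi1 : chi 1 = z.
Proof. by rewrite /chi /= modn_small // expr1. Qed.

Lemma chi_neq0 s : chi s != 0.
Proof.
apply/negP => /eqP c0; have /eqP := chi0.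
by rewrite -(subrr s) chiD c0 mul0r eq_sym oner_eq0.
Qed.

Lemma chi_sum (I : Type) (r : seq I) (f : I -> 'F_p) :
  chi (\sum_(i <- r) f i) = \prod_(i <- r) chi (f i).
Proof. by elim/big_rec2: _ => [|i x y _ <-]; rewrite ?chi0 ?chiD. Qed.

Lemma normc_chi s : mod (chi s) = 1.
Proof.
apply/eqP; rewrite -(@pexpr_eq1 _ _ p) ?prime_gt0 ?normc_ge0 //.
by rewrite -normcX -exprM mulnC exprM zp expr1n Normc.normc1.
Qed.

Lemma sum_chi (c : 'F_p) : \sum_xi chi (xi * c) = (p%:R * (c == 0)%:R).
Proof.
have [->|c0] := eqVneq c 0.
  rewrite mulr1; under eq_bigr do rewrite mulr0 chi0.
  by rewrite sumr_const card_Fp.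
rewrite mulr0; set T := \sum_xi _.
have TE : z * T = T.
  rewrite /T [in RHS](reindex_inj (addrI c^-1)) mulr_sumr; apply: eq_bigr => xi _.
  by rewrite mulrDl mulVf // chiD chi1.
by apply/eqP; move/eqP: TE; rewrite -subr_eq0 -{2}[T]mul1r -mulrBl mulf_eq0 subr_eq0 (negbTE z1).
Qed.

Definition cdist s : R := mod (1 - chi s).

Lemma cdist0 : cdist 0 = 0. Proof. by rewrite /cdist chi0 subrr Normc.normc0. Qed.

Lemma cdist_ge0 s : 0 <= cdist s. Proof. exact: normc_ge0. Qed.

Lemma cdistD s t : cdist (s + t) <= cdist s + cdist t.
Proof.
rewrite /cdist chiD.
have -> : 1 - chi s * chi t = (1 - chi s) + chi s * (1 - chi t) by ring.
by apply: le_trans (le_normcD _ _) _; rewrite Normc.normcM normc_chi mul1r.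
Qed.

Lemma cdistN s : cdist (- s) = cdist s.
Proof.
have E : 1 - chi s = - (chi s * (1 - chi (- s))).
  by rewrite mulrBr mulr1 -chiD subrr chi0 opprB.
by rewrite /cdist E normcN Normc.normcM normc_chi mul1r.
Qed.

Section EntryCharacter.
Variables (n : nat) (S : finType) (e : S -> 'F_p).
Hypothesis S0 : (0 < #|S|)%N.

Definition phi s : R[i] := (\sum_x chi (s * e x)) / #|S|%:R.

(** Fourier inversion: by orthogonality the indicator of the hyperplane is an average of characters
    over [xi], and since coordinates are independent the average over rows factors into one [phi]
    per coordinate. *)
Lemma mass_hyperplane (V : 'M['F_p]_n) (v : 'cV_n) :
  (forall x : 'rV_n, (x <= V)%MS = (x *m v == 0)) ->
  ((mass (iid_row n e) V : R)%:C = (\sum_xi \prod_j phi (xi * v j 0)) / p%:R)%C.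
Proof.
move=> Vv.
have S0' : #|S|%:R != 0 :> R[i] by rewrite pnatr_eq0 -lt0n.
have p0 : p%:R != 0 :> R[i] by rewrite pnatr_eq0 -lt0n prime_gt0.
rewrite /mass /avg rmorphM fmorphV !rmorph_nat rmorph_sum /=.
apply: (canRL (mulfK p0)); rewrite mulrAC; apply: (canLR (mulfK _)).
  by rewrite pnatr_eq0 -lt0n card_iid_gt0.
rewrite !mulr_suml.
transitivity (\sum_(f : {ffun 'I_n -> S}) \sum_xi \prod_j chi (xi * v j 0 * e (f j))).
  apply: eq_bigr => f _; rewrite Vv rmorph_nat mulrC.
  have -> : (iid_row n e f *m v == 0) = (\sum_j v j 0 * e (f j) == 0).
    have E : (iid_row n e f *m v) 0 0 = \sum_j v j 0 * e (f j).
      by rewrite mxE; apply: eq_bigr => j _; rewrite mxE mulrC.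
    rewrite -E; apply/eqP/eqP => [->|E0]; first by rewrite mxE.
    by apply/matrixP => i j; rewrite !ord1 E0 mxE.
  rewrite -sum_chi; apply: eq_bigr => xi _.
  by rewrite mulr_sumr chi_sum; apply: eq_bigr => j _; rewrite mulrA.
rewrite exchange_big /=; apply: eq_bigr => xi _.
rewrite -(bigA_distr_bigA (fun j s => chi (xi * v j 0 * e s))) /phi big_split /=.
rewrite prodr_const card_ord card_ffun card_ord natrX exprVn.
by rewrite divfK // expf_neq0.
Qed.

End EntryCharacter.

End Characters.

(** * Geometric sums on the unit circle *)

Section GeometricSums.
Variable R : rcfType.
Implicit Types w : R[i].

Lemma normc_geometric w N : mod w = 1 ->
  mod (\sum_(k < N) w ^+ k) * mod (1 - w) <= 2.
Proof.
move=> w1; rewrite -Normc.normcM mulrC -normcN -mulNr opprB -subrX1.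
apply: le_trans (le_normcD _ _) _.
by rewrite normcN normcX w1 expr1n Normc.normc1.
Qed.

Lemma normc_geometric_le w N : mod w = 1 -> mod (\sum_(k < N) w ^+ k) <= N%:R.
Proof.
move=> w1; apply: le_trans (le_normc_sum _ _ _) _.
under eq_bigr do rewrite normcX w1 expr1n.
by rewrite sumr_const card_ord.
Qed.

Lemma sqr_normc_add1 w : mod w = 1 -> mod (1 + w) ^+ 2 = 4 - mod (1 - w) ^+ 2.
Proof.
move=> w1; have := sqr_normcE w; rewrite w1 !sqr_normcE.
by case: w {w1} => x y /=; nra.
Qed.

Lemma normc_add1 w : mod w = 1 -> mod (1 + w) <= 2 - mod (1 - w) ^+ 2 / 4.
Proof.
move=> w1; have := sqr_normc_add1 w1.
have := normc_ge0 (1 + w); have := sqr_ge0 (mod (1 - w)).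
set x := mod (1 - w) ^+ 2; set y := mod (1 + w) => x0 y0 yE.
have x4 : x <= 4 by have := sqr_ge0 y; lra.
by rewrite -(@ler_pXn2r _ 2) ?nnegrE //; nra.
Qed.

(* Pairing k with k + h inside blocks of length 2h, which fill at least half
   of the sum. *)
Lemma normc_geometric_pair w h N : mod w = 1 -> (0 < h)%N -> (2 * h <= N)%N ->
  mod (\sum_(k < N) w ^+ k) <= N%:R * (1 - mod (1 - w ^+ h) ^+ 2 / 16).
Proof.
move=> w1 h0 hN; set y := mod (1 - w ^+ h) ^+ 2.
have wk k : mod (w ^+ k) = 1 by rewrite normcX w1 expr1n.
have y0 : 0 <= y by apply: sqr_ge0.
have shift a b : \sum_(k < a + b) w ^+ k =
    \sum_(k < a) w ^+ k + w ^+ a * \sum_(k < b) w ^+ k.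
  rewrite big_split_ord /=; congr (_ + _).
  by rewrite mulr_sumr; apply: eq_bigr => k _; rewrite exprD.
have block : mod (\sum_(k < 2 * h) w ^+ k) <= (2 * h)%:R - h%:R * y / 4.
  rewrite mul2n -addnn shift -{1}[\sum_(k < h) _]mul1r -mulrDl Normc.normcM.
  have le1 := normc_add1 (wk h); have le2 := normc_geometric_le h w1.
  apply: (@le_trans _ _ ((2 - y / 4) * h%:R)).
    by apply: ler_pM => //; apply: normc_ge0.
  by rewrite natrD; lra.
have blocks q r : mod (\sum_(k < q * (2 * h) + r) w ^+ k) <=
    (q * (2 * h) + r)%:R - (q * h)%:R * y / 4.
  elim: q => [|q IHq].
    by rewrite !mul0n mul0r mul0r subr0 normc_geometric_le.
  rewrite mulSn -addnA shift; apply: le_trans (le_normcD _ _) _.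
  rewrite Normc.normcM wk mul1r; apply: le_trans (lerD block IHq) _.
  by rewrite natrD mulSn natrD; lra.
set q := (N %/ (2 * h))%N.
have := blocks q (N %% (2 * h))%N; rewrite -divn_eq => /le_trans; apply.
have : (N <= 4 * (q * h))%N.
  have := divn_eq N (2 * h); have : (N %% (2 * h) < 2 * h)%N by rewrite ltn_mod; lia.
  have : (0 < q)%N by rewrite divn_gt0 //; lia.
  rewrite -/q; nia.
rewrite -(ler_nat R) natrM; set Q := (q * h)%:R => NQ.
have : N%:R * y <= 4 * Q * y by rewrite ler_wpM2r.
lra.
Qed.

(** If x is the square of |1 - w|, that of |1 - w^2| is x(4 - x). For x <= 1 this lies between 2x
    and 4x: the lower bound drives the induction, the upper one preserves the smallness
    hypothesis. *)
Lemma normc_doubling w j : mod w = 1 -> 4 ^+ j * mod (1 - w) ^+ 2 <= 4 ->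
  2 ^+ j * mod (1 - w) ^+ 2 <= mod (1 - w ^+ (2 ^ j)) ^+ 2.
Proof.
elim: j w => [|j IHj] w w1 small; first by rewrite expr0 mul1r expn0 expr1.
have sq : mod (1 - w ^+ 2) ^+ 2 = mod (1 - w) ^+ 2 * (4 - mod (1 - w) ^+ 2).
  rewrite -sqr_normc_add1 // -exprMn -Normc.normcM; congr (mod _ ^+ 2); ring.
have x0 := sqr_ge0 (mod (1 - w)).
have p0 : 1 <= 4 ^+ j :> R by rewrite exprn_ege1 //; lra.
have q0 : 0 < 2 ^+ j :> R by rewrite exprn_gt0.
move: small; rewrite [4 ^+ j.+1]exprS [2 ^+ j.+1]exprS; set x := mod (1 - w) ^+ 2 in sq x0 * => small.
have x1 : x <= 1.
  have le4 : 1 * x <= 4 ^+ j * x by rewrite ler_wpM2r.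
  by move: small le4; rewrite -mulrA; set y := 4 ^+ j * x; lra.
have w21 : mod (w ^+ 2) = 1 by rewrite normcX w1 expr1n.
rewrite expnS exprM; apply: le_trans (IHj _ w21 _); rewrite sq.
  by rewrite -mulrA [2 * _]mulrCA ler_pM2l //; nra.
apply: le_trans small; rewrite [leRHS](_ : _ = 4 ^+ j * (4 * x)); last by ring.
by rewrite ler_wpM2l ?(le_trans ler01) //; nra.
Qed.

Lemma normc_sub1X w k : mod w = 1 -> mod (1 - w ^+ k) <= k%:R * mod (1 - w).
Proof.
move=> w1; rewrite -normcN opprB subrX1 Normc.normcM -normcN opprB mulrC.
by rewrite ler_wpM2r ?normc_ge0 ?normc_geometric_le.
Qed.

(* |sum|^2 is the sum of Re (w^i / w^j) = 1 - |w^i - w^j|^2 / 2. *)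
Lemma sqr_normc_geometric_ge w k : mod w = 1 ->
  k%:R ^+ 2 * (1 - k%:R ^+ 2 * mod (1 - w) ^+ 2 / 2) <=
  mod (\sum_(i < k) w ^+ i) ^+ 2.
Proof.
move=> w1.
have wk i : mod (w ^+ i) = 1 by rewrite normcX w1 expr1n.
set d := mod (1 - w).
have close i j : (i <= j)%N -> (j <= k)%N -> mod (w ^+ i - w ^+ j) ^+ 2 <= k%:R ^+ 2 * d ^+ 2.
  move=> ij jk; rewrite -exprMn lerXn2r ?nnegrE ?mulr_ge0 ?normc_ge0 ?ler0n //.
  have -> : w ^+ i - w ^+ j = w ^+ i * (1 - w ^+ (j - i)).
    by rewrite mulrBr mulr1 -exprD subnKC.
  rewrite Normc.normcM wk mul1r; apply: le_trans (normc_sub1X _ w1) _.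
  by rewrite ler_wpM2r ?normc_ge0 // ler_nat leq_subLR; lia.
have pair (i j : 'I_k) : 1 - k%:R ^+ 2 * d ^+ 2 / 2 <=
    complex.Re (w ^+ i) * complex.Re (w ^+ j) + complex.Im (w ^+ i) * complex.Im (w ^+ j).
  have : mod (w ^+ i - w ^+ j) ^+ 2 <= k%:R ^+ 2 * d ^+ 2.
    have [ij|/ltnW ji] := leqP i j; first by apply: close => //; apply: ltnW.
    by rewrite -normcN opprB; apply: close => //; apply: ltnW.
  have := sqr_normcE (w ^+ i); have := sqr_normcE (w ^+ j).
  rewrite !wk sqr_normcE; case: (w ^+ i) => a b; case: (w ^+ j) => a' b' /=.
  set K := _ * d ^+ 2; nra.
rewrite sqr_normcE !raddf_sum /= !expr2 !mulr_suml -big_split /=.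
apply: le_trans (_ : \sum_(i < k) \sum_(j < k) (1 - k%:R ^+ 2 * d ^+ 2 / 2) <= _).
  by rewrite !sumr_const !card_ord -mulrnA -[leRHS]mulr_natl natrM expr2.
apply: ler_sum => i _; rewrite !mulr_sumr -big_split /=; apply: ler_sum => j _.
exact: pair.
Qed.

End GeometricSums.

Lemma sum_injective_eq_le1 (R : numDomainType) (I : finType) (T : eqType) (f : I -> T) c :
  injective f -> \sum_i (f i == c)%:R <= 1 :> R.
Proof.
move=> f_inj; have [i0 /eqP fi0|none] := pickP (fun i => f i == c); last first.
  by rewrite big1 // => i _; rewrite none.
rewrite (bigD1 i0) //= big1 ?addr0; first by rewrite fi0 eqxx.
move=> i; rewrite -fi0; case: eqP => // fi; rewrite (inj_eq f_inj).
by case: eqP.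
Qed.

(** * The two entry distributions *)

Section SymmetricEntry.
Variables (R : rcfType) (p : nat).
Hypothesis p_pr : prime p.

Definition sym_residue m (k : 'I_(2 * m + 1)) : 'F_p := (k : nat)%:R - m%:R.

Lemma natr_Fp_inj N : (N <= p)%N -> injective (fun k : 'I_N => (k : nat)%:R : 'F_p).
Proof.
move=> Np i j /(congr1 val) /=; rewrite !val_Fp_nat // !modn_small => [E||].
- exact: val_inj.
- exact: leq_trans (ltn_ord j) Np.
- exact: leq_trans (ltn_ord i) Np.
Qed.

Lemma atom_sym_residue m c : (2 * m + 1 <= p)%N ->
  atom (@sym_residue m) c <= (2 * m + 1)%:R^-1 :> R.
Proof.
move=> mp; rewrite /atom /avg card_ord ler_piMl ?invr_ge0 ?ler0n //.
apply: sum_injective_eq_le1 => i j /addIr; exact: natr_Fp_inj.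
Qed.

Variables (z : R[i]).
Hypotheses (zp : z ^+ p = 1).
Notation chi := (@chi R p z).

Lemma chiMn s k : chi (s *+ k) = chi s ^+ k.
Proof.
elim: k => [|k IHk]; first by rewrite mulr0n expr0 chi0.
by rewrite mulrS exprS chiD // IHk.
Qed.

(** Shifting the symmetric interval by [m] multiplies the character sum by a number of modulus 1 and
    leaves a geometric sum. *)
Lemma normc_phi_sym m s :
  mod (phi z (@sym_residue m) s) =
  mod (\sum_(k < 2 * m + 1) chi s ^+ k) / (2 * m + 1)%:R.
Proof.
rewrite /phi card_ord Normc.normcM Normc.normcV normc_nat; congr (_ / _).
rewrite -[LHS]mul1r -(normc_chi p_pr zp (s * m%:R)) -Normc.normcM mulr_sumr.
congr (mod _); apply: eq_bigr => k _.
by rewrite -chiD // mulrBr addrC subrK mulr_natr chiMn.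
Qed.

Section Bounds.
Variables (m : nat) (s : 'F_p).
Let a := mod (phi z (@sym_residue m) s).
Let N0 : 0 < (2 * m + 1)%:R :> R. Proof. by rewrite ltr0n addn1. Qed.
Let w1 := normc_chi p_pr zp s.

Lemma normc_phi_sym01 : 0 <= a <= 1.
Proof.
rewrite normc_ge0 /= /a normc_phi_sym ler_pdivrMr // mul1r.
exact: normc_geometric_le.
Qed.

Lemma normc_phi_sym_decay : (2 * m + 1)%:R * a * cdist z s <= 2.
Proof.
rewrite /a normc_phi_sym [_ * (_ / _)]mulrC divfK ?gt_eqF //.
exact: normc_geometric.
Qed.

Lemma normc_phi_sym_pair h : (0 < h)%N -> (2 * h <= 2 * m + 1)%N ->
  a <= 1 - mod (1 - chi s ^+ h) ^+ 2 / 16.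
Proof.
move=> h0 hN; rewrite /a normc_phi_sym ler_pdivrMr // mulrC.
exact: normc_geometric_pair.
Qed.

End Bounds.

End SymmetricEntry.

Section LazyEntry.
Variables (R : rcfType) (p L0 L1 k : nat).
Hypothesis p_pr : prime p.
Hypothesis L_gt0 : (0 < L0 + L1)%N.
Hypothesis k_gt0 : (0 < k)%N.

(** A uniform element of this type encodes a lazy variable: the first component is a coin, with [L0]
    outcomes giving 0 and [L1] giving the difference of the two elements of ['I_k]. *)
Definition lazy_type : finType := (('I_L0 + 'I_L1) * ('I_k * 'I_k))%type.

Definition lazy_residue (q : lazy_type) : 'F_p :=
  if q.1 is inr _ then (q.2.1 : nat)%:R - (q.2.2 : nat)%:R else 0.

Lemma card_lazy : #|lazy_type| = ((L0 + L1) * (k * k))%N.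
Proof. by rewrite !card_prod card_sum !card_ord. Qed.

Lemma card_lazy_gt0 : (0 < #|lazy_type|)%N.
Proof. by rewrite card_lazy !muln_gt0 L_gt0 k_gt0. Qed.

Lemma sum_lazy (A : pzSemiRingType) (G : 'F_p -> A) :
  \sum_q G (lazy_residue q) = L0%:R * k%:R ^+ 2 * G 0 +
    L1%:R * \sum_(i < k) \sum_(j < k) G ((i : nat)%:R - (j : nat)%:R).
Proof.
rewrite -(pair_bigA _ (fun l ij => G (lazy_residue (l, ij)))) big_sumType /=.
congr (_ + _).
  rewrite (eq_bigr (fun=> k%:R ^+ 2 * G 0)); last first.
    move=> l _; rewrite /lazy_residue /= sumr_const card_prod !card_ord.
    by rewrite -[LHS]mulr_natl natrM expr2.
  by rewrite sumr_const card_ord -mulrA mulr_natl.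
set T := \sum_(i < k) _; rewrite (eq_bigr (fun=> T)) ?sumr_const ?card_ord ?mulr_natl //.
move=> l _; rewrite /lazy_residue /=.
by rewrite -(pair_bigA _ (fun i j : 'I_k => G ((i : nat)%:R - (j : nat)%:R))).
Qed.

Definition tau : R := L0%:R / (L0 + L1)%:R.

Let LR0 : 0 < (L0 + L1)%:R :> R. Proof. by rewrite ltr0n. Qed.
Let kR0 : 0 < k%:R :> R. Proof. by rewrite ltr0n. Qed.

Let kn0 : k%:R != 0 :> R. Proof. by rewrite gt_eqF. Qed.
Let Ln0 : L0%:R + L1%:R != 0 :> R. Proof. by rewrite -natrD gt_eqF. Qed.

Lemma tau_compl : 1 - tau = L1%:R / (L0 + L1)%:R.
Proof. by rewrite /tau natrD; field. Qed.

Lemma tau01 : 0 <= tau <= 1.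
Proof.
have := tau_compl; have : 0 <= L1%:R / (L0 + L1)%:R :> R by rewrite divr_ge0 ?ler0n.
have : 0 <= tau by rewrite divr_ge0 ?ler0n.
lra.
Qed.

Lemma atom_lazy c : (k <= p)%N ->
  atom lazy_residue c <= tau + (1 - tau) / k%:R.
Proof.
move=> kp; rewrite /atom /avg card_lazy (sum_lazy (fun x => (x == c)%:R)).
have row (j : 'I_k) : \sum_(i < k) ((i : nat)%:R - (j : nat)%:R == c :> 'F_p)%:R <= 1 :> R.
  apply: (sum_injective_eq_le1 _ (f := fun i : 'I_k => (i : nat)%:R - (j : nat)%:R)).
  by move=> i i' /addIr; apply: natr_Fp_inj.
rewrite exchange_big /=.
have rows : \sum_(j < k) \sum_(i < k) ((i : nat)%:R - (j : nat)%:R == c :> 'F_p)%:R <= k%:R :> R.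
  apply: le_trans (_ : \sum_(j < k) 1 <= _); first by apply: ler_sum.
  by rewrite sumr_const card_ord.
rewrite ler_pdivrMr; last by rewrite !natrM !mulr_gt0.
rewrite tau_compl /tau !natrM.
have -> : (L0%:R / (L0 + L1)%:R + L1%:R / (L0 + L1)%:R / k%:R) * ((L0 + L1)%:R * (k%:R * k%:R)) =
    L0%:R * k%:R ^+ 2 * 1 + L1%:R * k%:R :> R.
  by field; rewrite kn0 Ln0.
apply: lerD; last by rewrite ler_wpM2l ?ler0n.
by rewrite ler_wpM2l ?mulr_ge0 ?exprn_ge0 ?ler0n // lern1 leq_b1.
Qed.

Variables (z : R[i]).
Hypotheses (zp : z ^+ p = 1).
Notation chi := (@chi R p z).

Definition lazy_char s : R :=
  tau + (1 - tau) * (mod (\sum_(i < k) chi s ^+ i) / k%:R) ^+ 2.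

(** A difference of two independent copies has a squared modulus as Fourier coefficient. Being real
    and nonnegative, it lets the Fourier formula for Y hold exactly without moduli, while for X
    moduli give an upper bound. *)
Lemma phi_lazy s : phi z lazy_residue s = ((lazy_char s)%:C)%C.
Proof.
have w1 := normc_chi p_pr zp s.
set Z := \sum_(i < k) chi s ^+ i.
have ZE : \sum_(i < k) \sum_(j < k) chi (s * ((i : nat)%:R - (j : nat)%:R)) = ((mod Z ^+ 2)%:C)%C.
  have conj_chi : chi (- s) = (chi s)^*%C.
    apply: (mulfI (chi_neq0 p_pr zp s)); rewrite -chiD // subrr chi0.
    have := sqr_normcE (chi s); rewrite w1.
    case: (chi s) => x y /= E; apply/eqP; rewrite eq_complex /=.
    by apply/andP; split; apply/eqP; lra.
  transitivity (Z * Z^*%C).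
    rewrite /Z rmorph_sum big_distrlr /=; apply: eq_bigr => i _; apply: eq_bigr => j _.
    rewrite mulrBr chiD // mulr_natr chiMn // -mulNr mulr_natr chiMn // conj_chi.
    by congr (_ * _); rewrite -(rmorphXn (conjc (R := R))) .
  case: (Z) => x y; rewrite sqr_normcE /=; apply/eqP; rewrite eq_complex /=.
  by apply/andP; split; apply/eqP; ring.
rewrite /phi card_lazy (sum_lazy (fun x => chi (s * x))) mulr0 chi0 ZE mulr1.
rewrite /lazy_char tau_compl /tau -/Z.
have -> : L0%:R / (L0 + L1)%:R + L1%:R / (L0 + L1)%:R * (mod Z / k%:R) ^+ 2 =
   (L0%:R * k%:R ^+ 2 + L1%:R * mod Z ^+ 2) / ((L0 + L1) * (k * k))%:R :> R.
  by rewrite !natrM; field; rewrite kn0 Ln0.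
move: (mod Z ^+ 2) => y; rewrite (fmorph_div (real_complex R)) (rmorphD (real_complex R)).
rewrite !(rmorphM (real_complex R) _ _) -natrX !(rmorph_nat (real_complex R)).
by rewrite natrX.
Qed.

Lemma lazy_char_ge_tau s : tau <= lazy_char s.
Proof.
rewrite lerDl mulr_ge0 ?sqr_ge0 // subr_ge0; by case/andP: tau01.
Qed.

Lemma lazy_char_ge s :
  1 - (1 - tau) * k%:R ^+ 2 / 2 * cdist z s ^+ 2 <= lazy_char s.
Proof.
have w1 := normc_chi p_pr zp s.
have := sqr_normc_geometric_ge k w1; rewrite -/(cdist z s).
rewrite /lazy_char expr_div_n; set Z := mod _ ^+ 2; set c := cdist z s ^+ 2.
have [t0 t1] := andP tau01; have k2 : 0 < k%:R ^+ 2 :> R by rewrite exprn_gt0.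
rewrite mulrC -ler_pdivlMr //; set y := Z / _.
have : 0 <= 1 - tau by rewrite subr_ge0.
nra.
Qed.

End LazyEntry.

(** * Singular matrices *)

(** The chain adds rows one by one and the matrix stacks them, so the two spaces agree only up to
    [:=:]; hence the condition on [g]. The bijection [h] splits off the first row. *)
Lemma chain_iid_row (R : realFieldType) (F : finFieldType) n (S : finType) (e : S -> F)
    (g : 'M[F]_n -> R) k W :
    (forall U V : 'M_n, (U :=: V)%MS -> g U = g V) ->
  chain (iid_row n e) k g W =
  (\sum_(A : 'M[S]_(k, n)) g (W + map_mx e A)%MS) / (#|S| ^ (k * n))%:R.
Proof.
move=> g_eqmx; elim: k W => [|k IHk] W /=.
  rewrite (eq_bigr (fun=> g W)); last first.
    by move=> A _; apply: g_eqmx; rewrite [map_mx e A]flatmx0; apply: addsmx0.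
  by rewrite sumr_const card_mx mul0n expn0 mulr1n divr1.
rewrite /step (eq_avg (fun f => IHk _)) /avg -mulr_suml -mulrA -invfM -natrM.
rewrite card_ffun card_ord [(_ ^ (k * n) * _)%N]mulnC -expnD -mulSn; congr (_ / _).
pose h (q : {ffun 'I_n -> S} * 'M[S]_(k, n)) : 'M[S]_(1 + k, n) :=
  col_mx (\row_j q.1 j) q.2.
pose h' (A : 'M[S]_(1 + k, n)) : {ffun 'I_n -> S} * 'M[S]_(k, n) :=
  (finfun (usubmx A 0), dsubmx A).
have hK : cancel h h'.
  move=> [f A]; rewrite /h /h' col_mxKu col_mxKd /=; congr (_, _).
  by apply/ffunP => j; rewrite ffunE mxE.
have h'K : cancel h' h.
  move=> A; rewrite /h /h' /= -[RHS]vsubmxK; congr col_mx.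
  by apply/rowP => j; rewrite mxE ffunE.
rewrite pair_big /= [RHS](reindex h) /=; last by exists h' => q _.
apply: eq_bigr => [[f A]] _; apply: g_eqmx.
have hE : map_mx e (h (f, A)) = col_mx (iid_row n e f) (map_mx e A).
  by rewrite map_col_mx; congr col_mx; apply/rowP => j; rewrite !mxE.
rewrite -addsmxA; apply: adds_eqmx; first exact: eqmx_refl.
apply: eqmx_trans (addsmxE _ _) _; rewrite -hE.
exact: eqmx_refl.
Qed.

Definition singular_ratio (R : realFieldType) n m : R :=
  #|[set A : 'M['I_(2 * m + 1)]_n | singular_int (int_mx A)]|%:R /
  #|{: 'M['I_(2 * m + 1)]_n}|%:R.

Lemma singular_ratio_le_chain (R : realFieldType) n m p : prime p ->
  singular_ratio R n m <=
  chain (iid_row n (@sym_residue p m)) n (fun U => (\rank U < n)%N%:R) 0.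
Proof.
move=> p_pr; rewrite chain_iid_row; last by move=> U V ->.
rewrite /singular_ratio card_mx card_ord ler_wpM2r ?invr_ge0 ?ler0n //.
rewrite -sum1_card natr_sum big_mkcond /=; apply: ler_sum => A _.
rewrite inE; case: ifP => [|_]; last exact: ler0n.
move=> /eqP singA; rewrite ler_nat lt0b adds0mx.
have mapE : map_mx (@sym_residue p m) A = map_mx intr (int_mx A).
  by apply/matrixP => i j; rewrite !mxE /sym_residue /sym_entry rmorphB.
have := congr1 (fun x : int => x%:~R : 'F_p) singA; rewrite -det_map_mx -mapE rmorph0.
set B := map_mx _ A => detB.
rewrite ltn_neqAle rank_leq_row andbT; apply/negP => /eqP rkB.
have : B \in unitmx by rewrite -row_free_unit /row_free rkB.
by rewrite unitmxE detB unitr0.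
Qed.

Lemma mass_sym_residue (R : rcfType) n m p (U : 'M['F_p]_n) :
    prime p -> (1 < m)%N -> (2 * m + 1 <= p)%N ->
  mass (iid_row n (@sym_residue p m)) U <= 3^-1 ^+ (n - \rank U) :> R.
Proof.
move=> p_pr m1 Np.
have N3 : 3 <= (2 * m + 1)%:R :> R by rewrite (ler_nat R 3); clear -m1; lia.
apply: (@odlyzko R 'F_p n _ _ _ 3^-1).
- by rewrite card_ord addn1.
- by rewrite invr_ge0.
move=> c; apply: le_trans (atom_sym_residue R p_pr c Np) _.
by rewrite lef_pV2 ?posrE // (lt_le_trans _ N3).
Qed.

Lemma singular_ratio_ge0 (R : realFieldType) n m : 0 <= singular_ratio R n m.
Proof. by rewrite divr_ge0. Qed.

(** The chain of [n] rows started at 0 reaches full rank with probability at least 1/2. This serves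
    small [n], where the exponential bound may exceed 1. *)
Lemma singular_ratio_le_half (R : rcfType) n m : (1 < m)%N ->
  singular_ratio R n m <= 1 / 2.
Proof.
move=> m1; have [p Np p_pr] := prime_above (2 * m + 1).
apply: le_trans (singular_ratio_le_chain R n m p_pr) _.
have O0 : (0 < #|{ffun 'I_n -> 'I_(2 * m + 1)}|)%N.
  by apply: card_iid_gt0; rewrite card_ord addn1.
have := chain_independent O0 (fun U => mass_sym_residue R U p_pr m1 (ltnW Np))
  (k := n) (W := 0).
rewrite mxrank0 add0n leqnn => /(_ isT).
set r := iid_row n _; set E := chain r n _ 0 => full; set B := chain r n _ 0.
have : B + E <= 1.
  rewrite -[leRHS](chain_const r O0 n 1 0).
  pose f (b : bool) (U : 'M['F_p]_n) : R := if b then (\rank U < n)%N%:R else (\rank U == n)%:R.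
  have -> : B + E = \sum_b chain r n (f b) 0 by rewrite big_bool.
  rewrite -chain_sum; apply: ler_chain => U; rewrite big_bool /f /= -natrD lern1.
  by case: (ltngtP (\rank U) n).
have : 0 <= 3^-1 ^+ n :> R by rewrite exprn_ge0 // invr_ge0.
by lra.
Qed.

(** Any nonzero column of the cokernel works: its kernel contains [V] and has the same rank. *)
Lemma hyperplane_normal (F : fieldType) n (V : 'M[F]_n) : (0 < n)%N -> \rank V = n.-1 ->
  exists v : 'cV_n, forall x : 'rV_n, (x <= V)%MS = (x *m v == 0).
Proof.
move=> n0 rkV.
have ck : cokermx V != 0 by rewrite -mxrank_eq0 mxrank_coker rkV; move: n0; clear; lia.
have [j vj] : exists j, col j (cokermx V) != 0.
  apply/existsP; apply: contraNT ck; rewrite negb_exists => /forallP all0.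
  apply/eqP/matrixP => i j; have := all0 j; rewrite negbK => /eqP/colP/(_ i).
  by rewrite !mxE.
set v := col j _ in vj; exists v => x.
have Vk : (V <= kermx v)%MS.
  by apply/sub_kermxP; rewrite /v colE mulmxA mulmx_coker mul0mx.
have rkv : \rank v = 1%N by apply/eqP; rewrite eqn_leq rank_leq_col lt0n mxrank_eq0.
have /eqmxP eqV : (V == kermx v)%MS.
  have := mxrank_leqif_eq Vk; case=> _ <-; rewrite mxrank_ker rkv rkV subn1.
  exact: eqxx.
by rewrite eqV; apply/sub_kermxP/eqP.
Qed.

(** * The bound for singular matrices with free parameters *)

Section Bound.
Variables (R : rcfType) (n m L0 L1 k h r : nat).
Variables (lam th D eps0 : R).
Notation N := (2 * m + 1)%N.
Notation t := (tau R L0 L1).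
Notation bY := (t + (1 - t) / k%:R).
Hypothesis n_gt0 : (0 < n)%N.
Hypothesis L0_gt0 : (0 < L0)%N.
Hypothesis k_gt0 : (0 < k)%N.
Hypothesis h_gt0 : (0 < h)%N.
Hypothesis hN : (2 * h <= N)%N.
Hypothesis r_gt0 : (0 < r)%N.
Hypothesis lam_gt0 : 0 < lam.
Hypothesis th_gt0 : 0 < th.
Hypothesis th_tau : th <= t.
Hypothesis D_ge0 : 0 <= D.
Hypothesis kap_lam : 2 * ((1 - t) * k%:R ^+ 2 / 2) <= lam.
Hypothesis lamD : 1 <= lam * th ^+ 2 * D ^+ 2.
Hypothesis kapD : (1 - t) * k%:R ^+ 2 / 2 * (3 * r%:R * D) ^+ 2 <= 1 / 50.
Hypothesis decay : forall w : R[i], mod w = 1 -> N%:R * th ^+ 2 * mod (1 - w) <= 2 ->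
  lam * mod (1 - w) ^+ 2 <= mod (1 - w ^+ h) ^+ 2 / 16.
Hypothesis eps_r : th + 50 / 49 / r%:R <= eps0.
Hypothesis eps_N : 50 / 49 / N%:R <= eps0.
Hypothesis eps_half : eps0 <= 1 / 2.

Let L_gt0 : (0 < L0 + L1)%N. Proof. by rewrite addn_gt0 L0_gt0. Qed.

Let t01 : 0 <= t <= 1. Proof. exact: tau01. Qed.

Let t_gt0 : 0 < t. Proof. exact: lt_le_trans th_tau. Qed.

Lemma bY01 : 0 < bY <= 1.
Proof.
have [_ t1] := andP t01.
have k1 : 0 <= (k%:R^-1 : R) <= 1.
  by rewrite invr_ge0 ler0n invf_le1 ?ltr0n // ler1n.
have := t_gt0; have [] := andP k1; set x := k%:R^-1; move: t1; set y := t.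
by move=> *; nra.
Qed.

(** The hypothesis [decay] is invoked only where the coefficient of X exceeds th^2, and there the
    geometric sum bound provides its smallness condition. In the second alternative of
    [char_sum_compare] the mass for Y is nearly 1, and Odlyzko's bound 1/N suffices by [eps_N]. *)
Lemma mass_compare p (V : 'M['F_p]_n) : prime p -> (N <= p)%N -> \rank V = n.-1 ->
  mass (iid_row n (@sym_residue p m)) V <=
  1 / p%:R + eps0 * mass (iid_row n (@lazy_residue p L0 L1 k)) V.
Proof.
move=> p_pr Np rkV; have [v Vv] := hyperplane_normal n_gt0 rkV.
have [z zp z1] := root_of_unity_neq1 R p_pr.
pose a s := mod (phi z (@sym_residue p m) s).
pose b := @lazy_char R p L0 L1 k z.
have p0 : 0 < p%:R :> R by rewrite ltr0n prime_gt0.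
have N0 : 0 < N%:R :> R by rewrite ltr0n addn1.
set qX := mass _ V; set qY := mass _ V.
have S0X : (0 < #|'I_N|)%N by rewrite card_ord addn1.
have qXE := mass_hyperplane p_pr zp z1 (@sym_residue p m) S0X Vv.
have qYE := mass_hyperplane p_pr zp z1 (@lazy_residue p L0 L1 k) (card_lazy_gt0 L_gt0 k_gt0) Vv.
have qY_eq : qY = (\sum_xi \prod_j b (xi * v j 0)) / p%:R.
  apply: (fmorph_inj (real_complex R)); rewrite [LHS]qYE.
  rewrite (fmorph_div (real_complex R)) (rmorph_nat (real_complex R)); congr (_ / _).
  rewrite (rmorph_sum (real_complex R)); apply: eq_bigr => xi _.
  rewrite (rmorph_prod (real_complex R)); apply: eq_bigr => j _.
  exact: phi_lazy.
have qX0 : 0 <= qX by apply: mass_ge0.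
have qY0 : 0 <= qY by apply: mass_ge0.
have qX_le : qX <= (\sum_xi \prod_j a (xi * v j 0)) / p%:R.
  rewrite -(normc_real qX0) qXE Normc.normcM Normc.normcV normc_nat.
  rewrite ler_wpM2r ?invr_ge0 ?ler0n //; apply: le_trans (le_normc_sum _ _ _) _.
  by apply: ler_sum => xi _; rewrite normc_prod.
have kap0 : 0 <= (1 - t) * k%:R ^+ 2 / 2.
  by rewrite !mulr_ge0 ?invr_ge0 ?exprn_ge0 ?ler0n // subr_ge0; case/andP: t01.
have a_nrm s : th ^+ 2 < a s -> a s <= 1 - lam * cdist z s ^+ 2.
  move=> big; apply: le_trans (normc_phi_sym_pair p_pr zp s h_gt0 hN) _.
  rewrite lerD2l lerN2; apply: decay; first exact: normc_chi.
  apply: le_trans (normc_phi_sym_decay p_pr zp m s).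
  by rewrite ler_wpM2r ?normc_ge0 // ler_wpM2l ?(ltW N0) // ltW.
have cmp : (\sum_xi \prod_j a (xi * v j 0)) / p%:R <=
    1 / p%:R + (th + 50 / 49 / r%:R) * qY \/ 49 / 50 <= qY.
  rewrite qY_eq; apply: (@char_sum_compare R p n (cdist z) a b (fun j => v j 0)
    p_pr _ _ _ _ lam ((1 - t) * k%:R ^+ 2 / 2) th D r) => //.
  - exact: cdist0.
  - exact: cdist_ge0.
  - exact: cdistN.
  - exact: cdistD.
  - exact: normc_phi_sym01.
  - by move=> s; apply: le_trans th_tau _; apply: lazy_char_ge_tau.
  - exact: lazy_char_ge.
case: cmp => [le|big].
  apply: le_trans qX_le _; apply: le_trans le _.
  by rewrite lerD2l ler_wpM2r.
apply: ler_wpDl; first by rewrite divr_ge0 ?ler0n.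
have : qX <= N%:R^-1.
  have := @odlyzko R 'F_p n _ (@sym_residue p m) S0X (N%:R^-1) _
    (fun c => atom_sym_residue R p_pr c Np) V.
  rewrite rkV (_ : n - n.-1 = 1)%N ?expr1; last by move: n_gt0; clear; lia.
  by apply; rewrite invr_ge0 ler0n.
move=> qXN; apply: le_trans qXN _.
have e1 : 50 / 49 / N%:R * (49 / 50) <= eps0 * qY.
  apply: ler_pM eps_N big; last by rewrite divr_ge0.
  by rewrite !mulr_ge0 ?invr_ge0 ?ler0n.
by apply: le_trans e1; set x := N%:R^-1; lra.
Qed.

Lemma singular_ratio_bound : (1 < m)%N ->
  singular_ratio R n m <= 2 * (n%:R * (50 * bY ^+ uphalf n) +
    4 ^+ uphalf n * (eps0 / (49 / 50) ^+ 2) ^+ uphalf n).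
Proof.
move=> m1; have [b0 b1] := andP bY01.
(* Here [bY] is at least [t], hence at least 1 / (L0 + L1). A prime above [B] makes the error 1/p at
   most bY^u. *)
have [B Bb] : exists B : nat, bY ^- uphalf n < B%:R.
  exists ((L0 + L1) ^ uphalf n).+1; apply: (@le_lt_trans _ _ ((L0 + L1) ^ uphalf n)%:R); last first.
    by rewrite ltr_nat.
  have LR : 0 < (L0 + L1)%:R :> R by rewrite ltr0n.
  rewrite natrX -[leRHS]invrK lef_pV2 ?posrE ?invr_gt0 ?exprn_gt0 // -exprVn.
  rewrite lerXn2r ?nnegrE ?invr_ge0 ?(ltW LR) ?(ltW b0) //.
  apply: (@le_trans _ _ t).
    by rewrite /tau ler_peMl ?invr_ge0 ?(ltW LR) // ler1n.
  by rewrite lerDl divr_ge0 ?ler0n // subr_ge0; case/andP: t01.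
have [p pB p_pr] := prime_above (maxn B (maxn N k)).
move: pB; rewrite !gtn_max => /and3P[Bp Np kp].
apply: le_trans (singular_ratio_le_chain R n m p_pr) _.
apply: (singular_chain_bound (rY := iid_row n (@lazy_residue p L0 L1 k))) => //.
- by apply: card_iid_gt0; rewrite card_ord addn1.
- by apply: card_iid_gt0; apply: card_lazy_gt0.
- by move=> U; apply: mass_sym_residue => //; apply: ltnW.
- exact: bY01.
- move=> W; apply: odlyzko; [exact: card_lazy_gt0 | exact: ltW |].
  by move=> c; apply: atom_lazy => //; apply: ltnW.
- by rewrite eps_half andbT; apply: le_trans eps_N; rewrite divr_ge0 ?ler0n ?divr_ge0.
- move=> V rkV; apply: le_trans (mass_compare p_pr (ltnW Np) rkV) _.
  rewrite lerD2r mul1r invf_ple ?posrE ?exprn_gt0 ?ltr0n ?prime_gt0 //.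
  by apply: ltW; apply: lt_le_trans Bb _; rewrite ler_nat ltnW.
Qed.

End Bound.

(** * Choice of the parameters *)

Lemma expr_small (R : archiRealFieldType) (g c : R) : 0 < g < 1 -> 0 < c ->
  exists s, g ^+ s <= c.
Proof.
move=> /andP[g0 g1] c0.
pose y := g^-1 - 1.
have y0 : 0 < y by rewrite subr_gt0 invf_gt1.
have gE : g^-1 = 1 + y by rewrite /y; lra.
have bern s : 1 + s%:R * y <= g ^- s.
  elim: s => [|s IHs]; first by rewrite expr0 invr1 mul0r addr0.
  rewrite exprS invfM gE -natr1.
  apply: (@le_trans _ _ ((1 + y) * (1 + s%:R * y))).
    have : 0 <= s%:R * y by rewrite mulr_ge0 ?ler0n // ltW.
    by move: (s%:R) => x; nra.
  by rewrite ler_pM2l //; lra.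
pose s := Num.bound (c^-1 / y); exists s.
have : c^-1 / y < s%:R by apply: archi_boundP; rewrite divr_ge0 ?invr_ge0 // ltW.
rewrite ltr_pdivrMr // => lt.
rewrite -[c]invrK -[g ^+ s]invrK lef_pV2 ?posrE ?invr_gt0 ?exprn_gt0 //.
by apply: le_trans (bern s); lra.
Qed.

(** The reason is that u g^u is at most the sum 1 + g + ... + g^(u-1). *)
Lemma natr_mul_expr_le (R : realFieldType) (g : R) u : 0 <= g <= 1 ->
  u%:R * g ^+ u * (1 - g) <= 1 - g ^+ u.
Proof.
move=> /andP[g0 g1]; elim: u => [|u IHu]; first by rewrite mul0r mul0r expr0 subrr.
have p0 : 0 <= g ^+ u by rewrite exprn_ge0.
have p1 : g ^+ u <= 1 by rewrite exprn_ile1.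
move: IHu p0 p1; rewrite -natr1 exprS; move: (u%:R) (g ^+ u) => x y IHu y0 y1.
have : g * (x * y * (1 - g)) <= g * (1 - y) by rewrite ler_wpM2l.
have : 0 <= (1 - g) * (1 - g * y) by apply: mulr_ge0; [lra | nra].
by lra.
Qed.

(* With g = 1 - (1 - b)/4 one has b <= g^4, and u g^u is bounded. *)
Lemma power_bound (R : archiRealFieldType) (b A M : R) : 0 < b < 1 -> 1 <= A -> 1 <= M ->
  exists2 K, (0 < K)%N & forall (P : R) (u : nat), 0 <= P <= 1 / 2 -> (0 < u)%N ->
    P <= A * u%:R * b ^+ u -> P ^+ K * M ^+ u <= 1.
Proof.
move=> /andP[b0 b1] A1 M1.
pose g := 1 - (1 - b) / 4.
have g0 : 0 < g by rewrite /g; lra.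
have g1 : g < 1 by rewrite /g; lra.
have g01 : 0 < g < 1 by rewrite g0.
have bg : b <= g ^+ 4.
  rewrite /g; set y := (1 - b) / 4.
  have -> : b = 1 - 4 * y by rewrite /y; lra.
  have : 0 <= y <= 1 by apply/andP; split; rewrite /y; lra.
  by move=> /andP[y0 y1]; nra.
have M0 : 0 < M by lra.
pose B := (A / (1 - g)) ^+ 2.
have B0 : 0 < B by rewrite exprn_gt0 // divr_gt0; lra.
(* From [s] on, P^2 <= g^u holds, and the power [K1] brings g below 1/M. For u < s the bound P <=
   1/2 is raised to a power [K2] that beats M^s. *)
have [s gs] : exists s, g ^+ s <= B^-1 by apply: expr_small; rewrite ?g01 ?invr_gt0.
have [K1 gK1] : exists K1, g ^+ K1 <= M^-1 by apply: expr_small; rewrite ?g01 ?invr_gt0.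
have [K2 hK2] : exists K2, (1 / 2 : R) ^+ K2 <= (M ^+ s)^-1.
  apply: expr_small; last by rewrite invr_gt0 exprn_gt0.
  by apply/andP; split; lra.
exists (2 * K1 + K2).+1 => // P u /andP[P0 P2] u0 Pu.
have P1 : P <= 1 by lra.
have Mu0 : 0 < M ^+ u by rewrite exprn_gt0.
rewrite -ler_pdivlMr // div1r.
have [us|su] := ltnP u s.
  apply: (@le_trans _ _ (P ^+ K2)); first by apply: ler_wiXn2l => //; clear; lia.
  apply: (@le_trans _ _ ((1 / 2) ^+ K2)).
    by rewrite lerXn2r ?nnegrE //; lra.
  apply: le_trans hK2 _; rewrite lef_pV2 ?posrE ?exprn_gt0 //.
  by rewrite ler_weXn2l // ltnW.
apply: (@le_trans _ _ ((P ^+ 2) ^+ K1)).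
  by rewrite -exprM; apply: ler_wiXn2l => //; clear; lia.
apply: (@le_trans _ _ ((g ^+ u) ^+ K1)); last first.
  rewrite -exprM mulnC exprM -exprVn lerXn2r ?nnegrE ?exprn_ge0 ?invr_ge0 // ltW //.
rewrite lerXn2r ?nnegrE ?exprn_ge0 ?(ltW g0) //.
have gu0 : 0 < g ^+ u by rewrite exprn_gt0.
have gu1 : g ^+ u <= 1 by rewrite exprn_ile1 // ltW.
have ug : u%:R * g ^+ u <= 1 / (1 - g).
  rewrite ler_pdivlMr ?subr_gt0 //.
  have g01' : 0 <= g <= 1 by rewrite !ltW.
  by apply: le_trans (natr_mul_expr_le u g01') _; move: (g ^+ u) gu0; clear => x x0; lra.
have gus : g ^+ u <= B^-1.
  by apply: le_trans gs; apply: ler_wiXn2l => //; apply: ltW.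
(* Of the four factors g^u that dominate b^u, one absorbs u and the other three are weakened to one.
   Squaring then yields a spare g^u against the constant [B]. *)
have Pu2 : P <= A / (1 - g) * g ^+ u.
  apply: le_trans Pu _.
  apply: (@le_trans _ _ (A * (u%:R * g ^+ u) * (g ^+ u) ^+ 3)).
    have -> : A * (u%:R * g ^+ u) * (g ^+ u) ^+ 3 = A * u%:R * (g ^+ u) ^+ 4 by ring.
    rewrite ler_wpM2l ?mulr_ge0 ?ler0n //; first by lra.
    by rewrite -exprM mulnC exprM lerXn2r ?nnegrE ?exprn_ge0 // ltW.
  have g3 : (g ^+ u) ^+ 3 <= g ^+ u by move: (g ^+ u) gu0 gu1 => x *; rewrite -[leRHS]expr1 ler_wiXn2l // ltW.
  have A0 : 0 <= A by lra.
  have Aug : A * (u%:R * g ^+ u) <= A / (1 - g).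
    by rewrite ler_wpM2l //; move: ug; rewrite div1r.
  apply: ler_pM Aug g3; first by rewrite !mulr_ge0 // ltW.
  by rewrite exprn_ge0 // ltW.
apply: (@le_trans _ _ ((A / (1 - g) * g ^+ u) ^+ 2)).
  have c0 : 0 <= A / (1 - g) by rewrite divr_ge0; lra.
  by rewrite lerXn2r ?nnegrE // mulr_ge0 // ltW.
rewrite exprMn -/B [(g ^+ u) ^+ 2]expr2 mulrA ler_piMl ?(ltW gu0) //.
by rewrite mulrC -ler_pdivlMr // div1r.
Qed.

Lemma lazy_param_exists (R : rcfType) : exists L0 x, [/\ (0 < L0)%N,
  tau R L0 1 = 1 - x, 0 < x & x <= 1 / 1000 * (1 / 1000) * (1 / 1000) * (1 / 100)].
Proof.
(* The size 10^11 comes from [kapD]: with k = 2 and radius 12000 it asks for 2 x 12000^2 <= 1/50. *)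
pose y : R := 1000 * (1000 * (1000 * 100)).
have y0 : 0 < y by rewrite !mulr_gt0.
have [L0 L00 LE] : exists2 L0, (0 < L0)%N & L0%:R = y.
  exists (1000 * (1000 * (1000 * 100)))%N; last by rewrite !natrM.
  by rewrite !muln_gt0.
have x0 : 0 < (y + 1)^-1 by rewrite invr_gt0; lra.
exists L0, (y + 1)^-1; split => //.
  rewrite /tau natrD LE; move: y y0 {LE x0} => y y0.
  by field; rewrite gt_eqF //; lra.
apply: (@le_trans _ _ y^-1); first by rewrite lef_pV2 ?posrE //; lra.
by rewrite /y !div1r !invfM !mulrA.
Qed.

(* The entries of Y are nonzero with so small a probability x that the bound on
   the Fourier coefficients of Y holds on a ball of radius 3 * 10 * 400. *)
Lemma singular_ratio_small (R : realType) (M : R) : 1 <= M ->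
  exists2 K, (0 < K)%N & forall n m, (0 < n)%N -> (1 < m)%N -> m%:R <= M ->
    singular_ratio R n m ^+ K * m%:R ^+ n <= 1.
Proof.
move=> M1; have [L0 [x [L00 tE x0 xs]]] := lazy_param_exists R.
pose b : R := 1 - x / 2.
have b01 : 0 < b < 1 by apply/andP; split; rewrite /b; lra.
have M2 : 1 <= M ^+ 2 by rewrite exprn_ege1.
have A1 : 1 <= 202 :> R by lra.
have [K K0 HK] := power_bound b01 A1 M2; exists K => // n m n0 m1 mM.
set P := singular_ratio R n m; set u := uphalf n.
have /andP[nu un] := uphalf_bounds n.
have u0 : (0 < u)%N by rewrite /u; clear -n0; case: n n0.
have P0 : 0 <= P by apply: singular_ratio_ge0.
have mn : m%:R ^+ n <= (M ^+ 2) ^+ u.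
  rewrite -exprM; apply: (@le_trans _ _ (M ^+ n)); last by rewrite ler_weXn2l.
  by rewrite lerXn2r ?nnegrE ?ler0n // (le_trans ler01).
apply: (@le_trans _ _ (P ^+ K * (M ^+ 2) ^+ u)); first by rewrite ler_wpM2l ?exprn_ge0.
apply: HK => //; first by rewrite P0 singular_ratio_le_half.
have N5 : 5 <= (2 * m + 1)%:R :> R by rewrite (ler_nat R 5); clear -m1; lia.
have Ni : (2 * m + 1)%:R^-1 <= 5^-1 :> R by rewrite lef_pV2 ?posrE // (lt_le_trans _ N5).
(* Here k = 2, h = 1 and r = 10; D = 400 makes lam th^2 D^2 equal to 1. As N >= 5, the value 21/100
   exceeds 50/49/N, yet 4 eps0 / (49/50)^2 stays below 1. *)
have := @singular_ratio_bound R n m L0 1 2 1 10 (1 / 16) (1 / 100) 400 (21 / 100) n0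
  L00 isT isT.
rewrite tE => bound.
apply: le_trans (bound _ _ _ _ _ _ _ _ _ _ _ _ _ m1) _ => {bound}.
all: try by [].
all: try lra.
- by clear -m1; lia.
- by move=> w w1 _; rewrite expr1; lra.
have -> : 1 - x + (1 - (1 - x)) / 2 = b by rewrite /b; lra.
rewrite -/u -exprMn.
have b0 : 0 <= b by case/andP: b01 => /ltW.
have bu0 : 0 <= b ^+ u by rewrite exprn_ge0.
have e1 : (4 * (21 / 100 / (49 / 50) ^+ 2)) ^+ u <= b ^+ u.
  by rewrite lerXn2r ?nnegrE //; rewrite /b; lra.
have nu2 : n%:R <= 2 * u%:R :> R by rewrite -natrM ler_nat.
have u1 : 1 <= u%:R :> R by rewrite ler1n.
have : n%:R * b ^+ u <= 2 * u%:R * b ^+ u by rewrite ler_wpM2r.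
have : 1 * b ^+ u <= u%:R * b ^+ u by rewrite ler_wpM2r.
by move: e1; set X := _ ^+ u; lra.
Qed.

(* T = 2^l is about m^(1/16): the rows Y are zero with probability 1/T, and
   otherwise differences of uniform variables on {0, ..., T - 1}. *)
Section LargeEntries.
Variables (R : rcfType) (l m : nat).
Hypothesis l22 : (22 <= l)%N.
Hypothesis m_lb : (2 ^ (16 * l) <= m)%N.
Let T : R := 2 ^+ l.
Let y : R := T^-1.

Let T_gt0 : 0 < T. Proof. by rewrite exprn_gt0. Qed.

Let T_big : 2000 * 2000 <= T.
Proof.
apply: (@le_trans _ _ (2 ^+ 11 * 2 ^+ 11)); first by rewrite ler_pM //; lra.
by rewrite -exprD ler_weXn2l //; lra.
Qed.

Let T1 : 1 <= T. Proof. by apply: le_trans T_big; lra. Qed.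

Let Ty : T * y = 1. Proof. by rewrite mulfV // gt_eqF. Qed.

Let y_gt0 : 0 < y. Proof. by rewrite invr_gt0. Qed.

Let y_small : y <= 1 / 2000 * (1 / 2000).
Proof.
rewrite !div1r -invfM lef_pV2 ?posrE //; by rewrite mulr_gt0.
Qed.

Let tT : (2 ^ l)%:R = T. Proof. exact: natrX. Qed.

Lemma tau_large : tau R 1 (2 ^ l).-1 = y.
Proof. by rewrite /tau add1n prednK ?expn_gt0 // tT div1r. Qed.

Let N_lb : 2 * T ^+ 16 <= (2 * m + 1)%:R.
Proof.
rewrite /T -exprM mulnC -natrX -natrM ler_nat.
by move: (2 ^ (16 * l))%N m_lb => x; clear; lia.
Qed.

(** As N is at least 2 T^16, the hypothesis forces T^14 |1 - w| <= 1. This leaves room for 8l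
    squarings of w, which gain the factor 2^(8l) = T^8. *)
Lemma decay_large (w : R[i]) : Normc.normc w = 1 ->
  (2 * m + 1)%:R * y ^+ 2 * Normc.normc (1 - w) <= 2 ->
  T ^+ 8 / 16 * Normc.normc (1 - w) ^+ 2 <= Normc.normc (1 - w ^+ (2 ^ (8 * l))) ^+ 2 / 16.
Proof.
move=> w1; set c := Normc.normc (1 - w) => small.
have c0 : 0 <= c by apply: normc_ge0.
have c14 : T ^+ 14 * c <= 1.
  have le : 2 * T ^+ 16 * (y ^+ 2 * c) <= 2.
    by apply: le_trans small; rewrite -[leRHS]mulrA ler_wpM2r // mulr_ge0 // exprn_ge0 // ltW.
  have E : 2 * T ^+ 16 * (y ^+ 2 * c) = 2 * (T ^+ 14 * c).
    by rewrite /y; field; rewrite gt_eqF.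
  by move: le; rewrite E; set z := T ^+ 14 * c; lra.
have c8 : T ^+ 8 * c <= 1.
  by apply: le_trans c14; rewrite ler_wpM2r // ler_weXn2l.
have c80 : 0 <= T ^+ 8 * c by rewrite mulr_ge0 // exprn_ge0 // ltW.
have := @normc_doubling R w (8 * l) w1; rewrite -/c.
have -> : 2 ^+ (8 * l) = T ^+ 8 by rewrite mulnC exprM.
have -> : 4 ^+ (8 * l) * c ^+ 2 = (T ^+ 8 * c) ^+ 2.
  have -> : 4 ^+ (8 * l) = (T ^+ 8) ^+ 2.
    have -> : 4 = 2 ^+ 2 :> R by lra.
    by rewrite /T -!exprM (_ : 2 * (8 * l) = l * (8 * 2))%N //; clear; lia.
  by rewrite -exprMn.
move=> dbl.
have : (T ^+ 8 * c) ^+ 2 <= 4.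
  by move: (T ^+ 8 * c) c80 c8 => x; nra.
by move=> /dbl le; rewrite mulrAC ler_wpM2r ?invr_ge0.
Qed.

Lemma singular_ratio_large_bound n : (0 < n)%N ->
  singular_ratio R n m <= (1600 * y) ^+ uphalf n.
Proof.
move=> n0.
have k0 : (0 < 2 ^ l)%N by rewrite expn_gt0.
have l2 : (2 <= l)%N by apply: leq_trans l22.
have rT : (2 ^ (l - 2))%:R = T / 4 :> R.
  apply: (mulIf (_ : 4 != 0)); first by rewrite pnatr_eq0.
  rewrite divfK ?pnatr_eq0 // natrX /T -[in RHS](subnK l2) exprD.
  by congr (_ * _); lra.
have m1 : (1 < m)%N.
  by apply: leq_trans m_lb; rewrite -[1%N]/(2 ^ 0)%N ltn_exp2l // muln_gt0 (ltnW l2).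
have NT : T <= (2 * m + 1)%:R.
  apply: le_trans N_lb; apply: (@le_trans _ _ (T ^+ 16)).
    by rewrite -[leLHS]expr1 ler_weXn2l.
  by rewrite ler_peMl ?exprn_ge0 ?(ltW T_gt0) //; lra.
have Ny : (2 * m + 1)%:R^-1 <= y.
  by rewrite lef_pV2 ?posrE // (lt_le_trans T_gt0).
(* Here k = T, h = T^8 and r = T/4. The powers of T in lam, th and D give lam th^2 D^2 = 1 and kap
   (3rD)^2 < 9/2 T^-2; eps0 = 6/T exceeds th + 50/49/r, about 5.1/T. *)
have bound := @singular_ratio_bound R n m 1 (2 ^ l).-1 (2 ^ l) (2 ^ (8 * l)) (2 ^ (l - 2))
  (T ^+ 8 / 16) y (4 / T ^+ 3) (6 * y) n0 isT k0.
rewrite tau_large tT rT in bound.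
apply: le_trans (bound _ _ _ _ _ _ _ _ _ _ _ _ _ _ m1) _ => {bound}.
- by rewrite expn_gt0.
- have : (2 ^ (8 * l) <= 2 ^ (16 * l))%N by rewrite leq_exp2l // leq_mul2r orbT.
  by move: m_lb; move: (2 ^ (8 * l))%N (2 ^ (16 * l))%N => a b; clear; lia.
- by rewrite expn_gt0.
- by rewrite divr_gt0 // exprn_gt0.
- exact: y_gt0.
- exact: lexx.
- by rewrite divr_ge0 // exprn_ge0 // ltW.
- have -> : 2 * ((1 - y) * T ^+ 2 / 2) = (1 - y) * T ^+ 2 by field.
  apply: (@le_trans _ _ (T ^+ 2)).
    by rewrite ler_piMl ?exprn_ge0 ?(ltW T_gt0) // gerBl ltW.
  rewrite ler_pdivlMr // [T ^+ 8](exprD T 2 6) ler_pM2l ?exprn_gt0 //.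
  apply: (@le_trans _ _ (T ^+ 1)); last by rewrite ler_weXn2l.
  by rewrite expr1; apply: le_trans T_big; lra.
- have -> : T ^+ 8 / 16 * y ^+ 2 * (4 / T ^+ 3) ^+ 2 = 1; last exact: lexx.
  by rewrite /y; field; rewrite gt_eqF.
- have -> : (1 - y) * T ^+ 2 / 2 * (3 * (T / 4) * (4 / T ^+ 3)) ^+ 2 =
      (1 - y) * (9 / 2 * (y * y)).
    by rewrite /y; field; rewrite gt_eqF.
  have y2 : y * y <= 1 / 2000 by move: (y) y_gt0 y_small => x; nra.
  apply: (@le_trans _ _ (9 / 2 * (y * y))); last by move: y2; set z := y * y; lra.
  have yy0 : 0 <= 9 / 2 * (y * y) by apply: mulr_ge0; [lra | rewrite mulr_ge0 // ltW].
  by rewrite ler_piMl // gerBl ltW.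
- exact: decay_large.
- rewrite [(T / 4)^-1]invfM invrK -/y; move: (y) y_gt0 => x; lra.
- move: Ny; set x := _^-1; move: (y) y_gt0 => x'; lra.
- move: (y) y_small => x; lra.
set u := uphalf n.
have u0 : (0 < u)%N by rewrite /u; clear -n0; case: n n0.
have /andP[nu _] := uphalf_bounds n.
have b_ub : y + (1 - y) / T <= 2 * y.
  by rewrite -/y; move: (y) y_gt0 => x; nra.
have bu : (y + (1 - y) / T) ^+ u <= (2 * y) ^+ u.
  rewrite lerXn2r ?nnegrE ?mulr_ge0 ?(ltW y_gt0) // -/y.
  by move: (y) y_gt0 y_small => x; nra.
have eu : 4 ^+ u * (6 * y / (49 / 50) ^+ 2) ^+ u <= (25 * y) ^+ u.
  rewrite -exprMn lerXn2r ?nnegrE; move: (y) y_gt0 => x; lra.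
have n2 : n%:R <= 2 * 2 ^+ u :> R.
  rewrite -natrX -natrM ler_nat; apply: leq_trans nu _.
  by rewrite leq_mul2l /= ltnW // ltn_expl.
have yu0 : 0 <= y ^+ u by rewrite exprn_ge0 // ltW.
have p1 : 400 * 4 ^+ u <= 1600 ^+ u :> R.
  have -> : 1600 = 400 * 4 :> R by lra.
  rewrite exprMn ler_wpM2r ?exprn_ge0 // -[leLHS]expr1 ler_weXn2l //; lra.
have p2 : 4 * 25 ^+ u <= 1600 ^+ u :> R.
  have -> : 1600 = 64 * 25 :> R by lra.
  rewrite exprMn ler_wpM2r ?exprn_ge0 //; apply: (@le_trans _ _ 64); first by lra.
  by rewrite -[leLHS]expr1 ler_weXn2l //; lra.
apply: (@le_trans _ _ (2 * (2 * 2 ^+ u * (50 * (2 * y) ^+ u) + (25 * y) ^+ u))).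
  rewrite ler_wpM2l // lerD // ler_pM ?ler0n //.
    rewrite mulr_ge0 // exprn_ge0 // addr_ge0 ?mulr_ge0 ?subr_ge0 ?invr_ge0 //.
    - exact: ltW.
    - by move: (y) y_small => x; lra.
    - exact: ltW.
  by rewrite ler_wpM2l.
rewrite !exprMn.
have -> : 2 * (2 * 2 ^+ u * (50 * (2 ^+ u * y ^+ u)) + 25 ^+ u * y ^+ u) =
    (200 * (2 * 2) ^+ u + 2 * 25 ^+ u) * y ^+ u by rewrite exprMn; ring.
rewrite ler_wpM2r //; have -> : 2 * 2 = 4 :> R by lra.
by move: p1 p2; set a := 4 ^+ u; set b := 25 ^+ u; set c := 1600 ^+ u; lra.
Qed.

(** Since 1600^2 <= T, the square of the ratio is at most T^-u. From 16(l+1) <= 32l and n <= 2u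
    follows m^n <= T^(64u), which the 64th power of that square compensates. *)
Lemma singular_ratio_large n : (0 < n)%N -> (m <= 2 ^ (16 * l.+1))%N ->
  singular_ratio R n m ^+ 128 * m%:R ^+ n <= 1.
Proof.
move=> n0 m_ub; have := singular_ratio_large_bound n0; set u := uphalf n => Pu.
have P0 : 0 <= singular_ratio R n m by apply: singular_ratio_ge0.
have y0 := ltW y_gt0.
have P2 : singular_ratio R n m ^+ 2 <= y ^+ u.
  apply: (@le_trans _ _ (((1600 * y) ^+ u) ^+ 2)).
    have q0 : 0 <= (1600 * y) ^+ u by rewrite exprn_ge0 // mulr_ge0.
    by rewrite lerXn2r ?nnegrE.
  rewrite -exprM mulnC exprM lerXn2r ?nnegrE ?exprn_ge0 ?mulr_ge0 //.
  rewrite exprMn [y ^+ 2]expr2 mulrA ler_piMl //.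
  by move: (y) y_small => x; lra.
have mT : m%:R <= T ^+ 32.
  rewrite /T -exprM -natrX ler_nat; apply: leq_trans m_ub _.
  by rewrite leq_exp2l //; clear -l22; lia.
have /andP[nu _] := uphalf_bounds n.
have mn : m%:R ^+ n <= T ^+ (64 * u).
  apply: (@le_trans _ _ ((T ^+ 32) ^+ n)).
    by rewrite lerXn2r ?nnegrE ?exprn_ge0 ?(ltW T_gt0).
  by rewrite -exprM ler_weXn2l //; rewrite -/u in nu; clear -nu; lia.
apply: (@le_trans _ _ (y ^+ (64 * u) * T ^+ (64 * u))).
  apply: ler_pM mn => //; rewrite ?exprn_ge0 //.
  by rewrite (exprM _ 2 64) mulnC exprM lerXn2r ?nnegrE ?exprn_ge0.
by rewrite -exprMn mulrC Ty expr1n.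
Qed.

End LargeEntries.

Lemma singular_ratio_exponent (R : realType) : exists2 K, (0 < K)%N &
  forall n m, (0 < n)%N -> (1 < m)%N -> singular_ratio R n m ^+ K * m%:R ^+ n <= 1.
Proof.
have [e eE] : exists e, e = (16 * 22)%N by exists (16 * 22)%N.
have [|K K0 HK] := @singular_ratio_small R (2 ^+ e); first by rewrite exprn_ege1 // ler1n.
(* One exponent serves both ranges of m: the ratio is at most 1, so raising the exponent is
   harmless. *)
exists (K + 128)%N => [|n m n0 m1]; first by rewrite addn_gt0 K0.
have P0 := singular_ratio_ge0 R n m.
have P1 : singular_ratio R n m <= 1.
  by apply: le_trans (singular_ratio_le_half R n m1) _; lra.
have weaken k : (k <= K + 128)%N -> singular_ratio R n m ^+ k * m%:R ^+ n <= 1 ->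
    singular_ratio R n m ^+ (K + 128) * m%:R ^+ n <= 1.
  by move=> kK; apply: le_trans; rewrite ler_wpM2r ?exprn_ge0 // ler_wiXn2l.
(* The threshold 22 is the first [l] with 2^l >= 2000^2; below it m is at most 2^(16 * 22), a
   bounded range. *)
set x := trunc_log 2 m; pose l := (x %/ 16)%N.
have /andP[m_lb m_ub] : (2 ^ x <= m < 2 ^ x.+1)%N.
  by apply: trunc_log_bounds => //; apply: ltnW.
have xl : (x.+1 <= 16 * l.+1)%N by rewrite mulnC ltn_ceil.
have m_ub' : (m <= 2 ^ (16 * l.+1))%N.
  by apply: leq_trans (ltnW m_ub) _; rewrite leq_exp2l.
have [l22|l22] := leqP 22 l; last first.
  apply: (weaken K); first exact: leq_addr.
  apply: HK => //; rewrite -natrX ler_nat; apply: leq_trans m_ub' _.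
  by rewrite leq_exp2l // eE leq_pmul2l.
apply: (weaken 128); first exact: leq_addl.
apply: singular_ratio_large n0 m_ub' => //; apply: leq_trans m_lb.
by rewrite leq_exp2l // mulnC leq_trunc_div.
Qed.

(* Real exponents and the final statement *)
Local Close Scope ring_scope.
From Stdlib Require Import Reals.

(** The [K]-th power of the right side is x^-n, so a larger [P] would contradict the hypothesis. *)
Lemma Rle_Rpower_of_pow (P x : R) (n K : nat) : K <> O -> Rlt 0 x -> Rle 0 P ->
  Rle (Rmult (pow P K) (pow x n)) 1 ->
  Rle P (Rpower x (Ropp (Rmult (Rdiv 1 (INR K)) (INR n)))).
Proof.
move=> K0 x0 P0 le1; set r := Rpower _ _.
have r0 : Rlt 0 r by apply: exp_pos.
have KR : INR K <> IZR 0 by apply: not_0_INR.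
have rK : pow r K = Rinv (pow x n).
  rewrite -Rpower_pow // /r Rpower_mult -(Rpower_pow n) // -Rpower_Ropp.
  by congr Rpower; field.
have xn : Rlt 0 (pow x n) by apply: pow_lt.
apply: Rnot_lt_le => /RltP rP.
have : Rlt (pow r K) (pow P K).
  rewrite !RpowE; apply/RltP; rewrite ltrXn2r //; first by apply/eqP.
  by apply/RleP/Rlt_le.
apply: Rle_not_lt; rewrite rK -[Rinv _]Rmult_1_l.
apply: (Rmult_le_reg_r (pow x n)) => //.
by rewrite /Rdiv Rmult_assoc Rinv_l ?Rmult_1_r //; apply: Rgt_not_eq.
Qed.

Theorem theorem1 :
  exists c : R, Rlt 0 c /\
    forall n m : nat, (1 <= n)%N -> (1 <= m)%N ->
      Rle (prob_singular n m) (Rpower (INR m) (Ropp (Rmult c (INR n)))).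
Proof.
have [K K0 HK] := singular_ratio_exponent R.
exists (Rdiv 1 (INR K)); split.
  by apply: Rdiv_lt_0_compat; [exact: Rlt_0_1 | apply: lt_0_INR; apply/ssrnat.ltP].
move=> n m n0 m0.
have -> : prob_singular n m = singular_ratio R n m.
  by rewrite /prob_singular /singular_ratio RdivE !INRE.
(* For m = 1 the bound is 1, as ln 1 = 0. *)
have [m1|m1] := leqP m 1.
  have -> : m = 1 by apply/eqP; rewrite eqn_leq m1.
  rewrite /Rpower ln_1 Rmult_0_r exp_0; apply/RleP.
  by rewrite ler_pdivrMr ?mul1r ?ler_nat ?max_card // ltr0n card_mx expn_gt0 card_ord addn1.
apply: Rle_Rpower_of_pow.
- by case: K K0 {HK}.
- by apply: lt_0_INR; apply/ssrnat.ltP.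
- by apply/RleP; apply: singular_ratio_ge0.
- by rewrite !RpowE INRE; apply/RleP; apply: HK.
Qed.
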